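(* Let $\Gamma\subset\mathbb R$, $X\subset\mathbb R^{n_x}$, $\Theta\subset\mathbb R^{n_\theta}$ be compact, and let $f\in C^1(\Gamma\times\mathbb R^{n_x}\times\Theta)$ ($\mathbb R^{n_x}$-valued) be locally Lipschitz with $\nabla_xf,\nabla_\theta f$ locally Lipschitz continuous. Let $a=2\sup_{x\in X}\|x\|_2$ and $0<T<\min\{\frac1{K_x},\frac a{2M}\}$, with $[0,T]\subset\Gamma$. Let $\phi$ be the solution map of the ODE defined by $f$. Then for all $\mathbf u\in C_a[0,T]$ and all $(t,x,\theta)\in[0,T]\times X\times\Theta$, $$\lim_{n\to\infty}\nabla_{x,\theta}(\mathcal P^n_{0,x,\theta}\mathbf u)(t)=\nabla_{x,\theta}\phi(t,x,\theta).$$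
   Context: $B_a=\{x\in\mathbb R^{n_x}:\|x\|_2\le a\}$, $C_a[0,T]=\{\mathbf u\in C([0,T];\mathbb R^{n_x}):\|\mathbf u\|_\infty\le a\}$, $$K_x=\sup_{x\ne y\in B_a,\,t\in\Gamma,\,\theta\in\Theta}\frac{\|f(t,x,\theta)-f(t,y,\theta)\|_2}{\|x-y\|_2},\qquad M=\sup_{x\in B_a,\,t\in\Gamma,\,\theta\in\Theta}\|f(t,x,\theta)\|_2 .$$ The Picard operator is $(\mathcal P_{t_0,x,\theta}\mathbf u)(t)=x+\int_0^tf(s+t_0,\mathbf u(s),\theta)\,ds$, $t\in[0,T]$; $\mathcal P^n$ is its $n$-fold composition. $\nabla_{x,\theta}$ denotes the derivative with respect to $(x,\theta)$. The solution map $\phi$ is the (assumed existing, unique) function with $\partial_t\phi(t,x,\theta)=f(t,\phi(t,x,\theta),\theta)$, $\phi(0,x,\theta)=x$. *)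

(* Defs.v *)
From HB Require Import structures.
From mathcomp Require Import all_boot all_order all_algebra.
From mathcomp Require Import all_classical all_reals all_analysis.
Set Implicit Arguments.
Unset Strict Implicit.
Unset Printing Implicit Defensive.
Import Order.TTheory GRing.Theory Num.Theory.
Import numFieldNormedType.Exports.
Local Open Scope classical_set_scope.
Local Open Scope ring_scope.

(* The library norm on ['rV[R]_n] is the maximum norm; the constants [a],
   [Kx] and [M] below depend on the Euclidean one. *)
Definition norm2 (R : realType) (n : nat) (x : 'rV[R]_n) : R :=
  Num.sqrt (\sum_(i < n) x 0 i ^+ 2).

Definition cball2 (R : realType) (n : nat) (a : R) : set 'rV[R]_n :=
  [set x | norm2 x <= a].

(* C_a[0,T]; values outside [0,T] are irrelevant. *)
Definition Ca (R : realType) (n : nat) (a T : R) : set (R -> 'rV[R]_n) :=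
  [set u | {within `[0, T], continuous u} /\
           {in `[0, T], forall t, norm2 (u t) <= a}].

(* C^1 on an arbitrary, not necessarily open, set [S]: C^1 on an open
   neighbourhood of [S].  In finite dimension continuity of the derivative
   amounts to continuity of [fun y => 'd g y v] for every direction [v]. *)
Definition C1_on (R : realType) (V W : normedModType R) (S : set V)
    (g : V -> W) : Prop :=
  exists U : set V, [/\ open U, S `<=` U &
    forall z, U z -> differentiable g z /\
      forall v : V, {for z, continuous (fun y : V => 'd g y v)}].

Section ode.
Variables (R : realType) (nx np : nat).
Implicit Types (t T : R) (x : 'rV[R]_nx) (p : 'rV[R]_np).
Variable f : R -> 'rV[R]_nx -> 'rV[R]_np -> 'rV[R]_nx.

Definition joint (m k : nat)
    (g : R -> 'rV[R]_nx -> 'rV[R]_np -> 'M[R]_(m, k))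
    (z : R * 'rV[R]_nx * 'rV[R]_np) : 'M[R]_(m, k) := g z.1.1 z.1.2 z.2.

(* Row-vector convention: the (i, j) entry is the derivative of the j-th
   component in the i-th variable, the transpose of the usual Jacobian. *)
Definition grad_x t x p : 'M[R]_(nx, nx) := 'J (fun y => f t y p) x.

Definition grad_p t x p : 'M[R]_(np, nx) := 'J (fun q => f t x q) p.

Definition twice_sup_norm2 (X : set 'rV[R]_nx) : R := 2 * sup [set norm2 x | x in X].

(* Suprema and the bounds 1/Kx and a/(2M) are taken in the extended reals,
   so that 1/0 = +oo. *)
Definition Kx (Gam : set R) (Theta : set 'rV[R]_np) (a : R) : \bar R :=
  ereal_sup [set r : \bar R | exists t x y p,
    [/\ Gam t, Theta p, cball2 a x, cball2 a y &
        x <> y /\ r = (norm2 (f t x p - f t y p) / norm2 (x - y))%:E]].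

Definition Mf (Gam : set R) (Theta : set 'rV[R]_np) (a : R) : \bar R :=
  ereal_sup [set r : \bar R | exists t x p,
    [/\ Gam t, Theta p, cball2 a x & r = (norm2 (f t x p))%:E]].

Definition picard (t0 : R) x p (u : R -> 'rV[R]_nx) : R -> 'rV[R]_nx :=
  fun t => x + \row_(i < nx)
    (\int[lebesgue_measure]_(s in `[0, t]) (f (s + t0) (u s) p 0 i)).

Definition picard_iter (n : nat) (t0 : R) x p (u : R -> 'rV[R]_nx) :
    R -> 'rV[R]_nx :=
  iter n (picard t0 x p) u.

(* [phi] solves the initial value problem on [0,T] for every (x, p) in [D];
   the time derivative is relative to [0,T], hence one-sided at 0 and T. *)
Definition solution_map (T : R) (D : set ('rV[R]_nx * 'rV[R]_np))
    (phi : R -> 'rV[R]_nx -> 'rV[R]_np -> 'rV[R]_nx) : Prop :=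
  forall x p, D (x, p) -> phi 0 x p = x /\
    forall t, t \in `[0, T] ->
      h^-1 *: (phi (t + h) x p - phi t x p)
        @[h --> within [set h : R | t + h \in `[0, T]] 0^']
      --> f t (phi t x p) p.

End ode.

Definition uncurry_row (R : realType) (nx np m : nat)
    (g : 'rV[R]_nx -> 'rV[R]_np -> 'rV[R]_m) (z : 'rV[R]_(nx + np)) :
    'rV[R]_m :=
  g (lsubmx z) (rsubmx z).

Definition differentiable_xp (R : realType) (nx np m : nat)
    (g : 'rV[R]_nx -> 'rV[R]_np -> 'rV[R]_m) x p : Prop :=
  differentiable (uncurry_row g) (row_mx x p).

Definition grad_xp (R : realType) (nx np m : nat)
    (g : 'rV[R]_nx -> 'rV[R]_np -> 'rV[R]_m) x p : 'M[R]_(nx + np, m) :=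
  'J (uncurry_row g) (row_mx x p).

(* Main.v *)
Require Import Defs.
From HB Require Import structures.
From mathcomp Require Import all_boot all_order all_algebra.
From mathcomp Require Import all_classical all_reals all_analysis.
From mathcomp Require Import ring lra.
Set Implicit Arguments.
Unset Strict Implicit.
Unset Printing Implicit Defensive.
Import Order.TTheory GRing.Theory Num.Theory.
Import numFieldNormedType.Exports.
Local Open Scope classical_set_scope.
Local Open Scope ring_scope.

(** Write [z = (y, q)] for the initial value and the parameter, and [u_n(z)] for
    the [n]th Picard iterate. Differentiating the Picard recursion gives matrices
    [J_n] that satisfy the Picard recursion of the linearised equation along
    the iterates ([iter_jacobian]). The point is that the expansion
      [u_n(z + h) = u_n(z) + h J_n + o(h)]
    holds uniformly in [n] and in time ([joint_iter_diff]). Indeed, on a compact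
    tube around the curves the field is Lipschitz in [z] and its first-order
    remainder is uniformly small; in a norm weighted by [expR (2 * L * s)], with
    [L] a Lipschitz constant, one integration halves the error inherited from
    the previous iterate, so the error never accumulates.

    Such uniformity makes the convergence of the derivatives a consequence of
    pointwise convergence ([jacobian_limit]): the value of [J_n] on a small
    vector is known, up to a small relative error that does not depend on [n],
    from the values of [u_n] at two points, and these converge. So [J_n] is a
    Cauchy sequence, and passing to the limit in the expansion shows that the
    limit of the [u_n] is differentiable with derivative [lim J_n].

    It remains to know that [u_n(z)] converges to [phi] for all [z] near the given
    point, including parameters outside [Theta]. The weighted estimate gives the
    convergence ([joint_iter_cvg]) towards any solution of the integral equation
    in the ball of radius [a]. The bound on [T] says that a curve that starts in
    the ball of radius [a / 2] cannot leave the ball of radius [a] before time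
    [T], with room to spare; this applies to the iterates and, by a continuity
    argument ([solution_stays]), to [phi]. The fundamental theorem of calculus
    turns the differential equation into the integral one. *)

(** * Norms of matrices and vectors *)

Section matrix_norm.
Variable R : realType.

Lemma norm_mx_entry (m n : nat) (A : 'M[R]_(m, n)) i j : `|A i j| <= `|A|.
Proof.
rewrite [leRHS]/Num.Def.normr/= mx_normrE.
exact: (le_bigmax _ (fun ij => `|A ij.1 ij.2|) (i, j)).
Qed.

Lemma norm_mx_le (m n : nat) (A : 'M[R]_(m, n)) c :
  0 <= c -> (forall i j, `|A i j| <= c) -> `|A| <= c.
Proof.
move=> c0 Ac; rewrite [leLHS]/Num.Def.normr/= mx_normrE.
by rewrite (bigmax_le _ c0).
Qed.

Lemma norm_mulmx (m n q : nat) (A : 'M[R]_(m, n)) (B : 'M[R]_(n, q)) :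
  `|A *m B| <= n%:R * `|A| * `|B|.
Proof.
apply: norm_mx_le => [|i j]; first by rewrite !mulr_ge0.
rewrite mxE (le_trans (ler_norm_sum _ _ _))//.
rewrite -mulrA -[n in n%:R]card_ord mulr_natl -sumr_const.
by apply: ler_sum => k _; rewrite normrM ler_pM ?norm_mx_entry.
Qed.

Lemma norm_lsubmx (m n1 n2 : nat) (A : 'M[R]_(m, n1 + n2)) : `|lsubmx A| <= `|A|.
Proof. by apply: norm_mx_le => // i j; rewrite mxE norm_mx_entry. Qed.

Lemma norm_rsubmx (m n1 n2 : nat) (A : 'M[R]_(m, n1 + n2)) : `|rsubmx A| <= `|A|.
Proof. by apply: norm_mx_le => // i j; rewrite mxE norm_mx_entry. Qed.

Lemma norm_row_mx (m n1 n2 : nat) (A : 'M[R]_(m, n1)) (B : 'M[R]_(m, n2)) c :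
  `|A| <= c -> `|B| <= c -> `|row_mx A B| <= c.
Proof.
move=> Ac Bc; apply: norm_mx_le => [|i j]; first exact: le_trans Ac.
rewrite mxE; case: splitP => k _; first exact: le_trans (norm_mx_entry _ _ _) Ac.
exact: le_trans (norm_mx_entry _ _ _) Bc.
Qed.

Lemma cvg_mxP (T : Type) (F : set_system T) (FF : Filter F) (m n : nat)
    (g : T -> 'M[R]_(m, n)) (A : 'M[R]_(m, n)) :
  (forall i j, g x i j @[x --> F] --> A i j) -> g x @[x --> F] --> A.
Proof.
move=> gA; apply/cvgrPdist_le => /= e e0.
have : \forall x \near F, forall i j, `|A i j - g x i j| <= e.
  apply: filter_forall => i; apply: filter_forall => j.
  by move: e e0; apply/cvgrPdist_le.
by apply: filterS => x xe; apply: norm_mx_le => [|i j]; [exact: ltW|rewrite !mxE].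
Qed.

Lemma cvg_mx_entry (T : Type) (F : set_system T) (FF : Filter F) (m n : nat)
    (g : T -> 'M[R]_(m, n)) (A : 'M[R]_(m, n)) i j :
  g x @[x --> F] --> A -> g x i j @[x --> F] --> A i j.
Proof. by move=> gA; exact: (cvg_comp _ _ gA (@coord_continuous _ _ _ i j A)). Qed.

Lemma cvg_row_mx (T : Type) (F : set_system T) (FF : Filter F) (m n1 n2 : nat)
    (g : T -> 'M[R]_(m, n1)) (h : T -> 'M[R]_(m, n2)) (A : 'M[R]_(m, n1)) (B : 'M[R]_(m, n2)) :
  g x @[x --> F] --> A -> h x @[x --> F] --> B ->
  row_mx (g x) (h x) @[x --> F] --> row_mx A B.
Proof.
move=> gA hB; apply: cvg_mxP => i j; rewrite mxE.
under eq_fun do rewrite mxE.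
by case: fintype.split => k; exact: cvg_mx_entry.
Qed.

Lemma cvg_mulmx (T : Type) (F : set_system T) (FF : Filter F) (m n q : nat)
    (g : T -> 'M[R]_(m, n)) (h : T -> 'M[R]_(n, q)) (A : 'M[R]_(m, n)) (B : 'M[R]_(n, q)) :
  g x @[x --> F] --> A -> h x @[x --> F] --> B ->
  g x *m h x @[x --> F] --> A *m B.
Proof.
move=> gA hB; apply: cvg_mxP => i j; rewrite mxE.
under eq_fun do rewrite mxE.
apply: cvg_big => [|k _]; first exact: (@add_continuous R).
by apply: cvgM; exact: cvg_mx_entry.
Qed.

End matrix_norm.

Section euclidean_norm.
Variables (R : realType) (n : nat).
Implicit Types x y : 'rV[R]_n.

Definition dot x y : R := \sum_(i < n) x 0 i * y 0 i.

Lemma mulmx_dot x y : (x *m y^T) 0 0 = dot x y.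
Proof. by rewrite mxE; apply: eq_bigr => i _; rewrite mxE. Qed.

Lemma norm2_ge0 x : 0 <= norm2 x. Proof. exact: sqrtr_ge0. Qed.

Lemma sqr_norm2 x : norm2 x ^+ 2 = dot x x.
Proof.
rewrite /norm2 sqr_sqrtr; last by apply: sumr_ge0 => i _; rewrite sqr_ge0.
by apply: eq_bigr => i _; rewrite expr2.
Qed.

Lemma norm2_entry x i : `|x 0 i| <= norm2 x.
Proof.
rewrite -ler_sqr ?nnegrE ?norm2_ge0// sqr_norm2 /dot (bigD1 i)//= real_normK ?num_real//.
by rewrite expr2 lerDl sumr_ge0// => k _; rewrite -expr2 sqr_ge0.
Qed.

(** Cauchy-Schwarz, from the nonnegativity of the square of
    [norm2 y *: x - norm2 x *: y]. *)
Lemma dot_le x y : dot x y <= norm2 x * norm2 y.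
Proof.
have [x0|x0] := eqVneq (norm2 x) 0.
  rewrite x0 mul0r /dot big1// => i _.
  by have := norm2_entry x i; rewrite x0 normr_le0 => /eqP ->; rewrite mul0r.
have [y0|y0] := eqVneq (norm2 y) 0.
  rewrite y0 mulr0 /dot big1// => i _.
  by have := norm2_entry y i; rewrite y0 normr_le0 => /eqP ->; rewrite mulr0.
have xy0 : 0 < norm2 x * norm2 y by rewrite mulr_gt0// lt0r ?x0 ?y0 norm2_ge0.
have : 0 <= \sum_(i < n) (norm2 y * x 0 i - norm2 x * y 0 i) ^+ 2.
  by apply: sumr_ge0 => i _; rewrite sqr_ge0.
have -> : \sum_(i < n) (norm2 y * x 0 i - norm2 x * y 0 i) ^+ 2 =
    norm2 y ^+ 2 * dot x x + norm2 x ^+ 2 * dot y y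
      - 2 * (norm2 x * norm2 y) * dot x y.
  rewrite /dot !mulr_sumr -big_split/= -sumrB; apply: eq_bigr => i _; ring.
rewrite -!sqr_norm2 => h; rewrite -(ler_pM2l xy0); lra.
Qed.

Lemma norm2D x y : norm2 (x + y) <= norm2 x + norm2 y.
Proof.
rewrite -ler_sqr ?nnegrE ?addr_ge0 ?norm2_ge0// sqr_norm2.
have -> : dot (x + y) (x + y) = dot x x + dot y y + 2 * dot x y.
  rewrite /dot mulr_sumr -!big_split/=; apply: eq_bigr => i _; rewrite !mxE; ring.
rewrite -!sqr_norm2; have := dot_le x y; lra.
Qed.

Lemma continuous_norm2 : continuous (@norm2 R n).
Proof.
move=> x; apply: (continuous_comp (f := fun x : 'rV[R]_n => \sum_(i < n) x 0 i ^+ 2)).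
  have Fx : Filter (nbhs x) by exact: nbhs_filter.
  apply: (@cvg_big R _ +%R 0 _ (@add_continuous R) _ (nbhs x)) => i _.
  by under eq_fun do rewrite expr2; rewrite expr2; apply: cvgM; exact: cvg_mx_entry.
exact: sqrt_continuous.
Qed.

Lemma norm2_convex (x y : 'rV[R]_n) (l c : R) : 0 <= l <= 1 ->
  norm2 x <= c -> norm2 y <= c -> norm2 (x + l *: (y - x)) <= c.
Proof.
have norm2Z k (z : 'rV[R]_n) : 0 <= k -> norm2 (k *: z) = k * norm2 z.
  move=> k0; rewrite /norm2 -{2}(ger0_norm k0) -sqrtr_sqr -sqrtrM ?sqr_ge0//.
  congr Num.sqrt; rewrite mulr_sumr; apply: eq_bigr => i _.
  by rewrite mxE exprMn.
move=> /andP[l0 l1] xc yc.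
have -> : x + l *: (y - x) = (1 - l) *: x + l *: y.
  by apply/matrixP => i j; rewrite !mxE; ring.
rewrite (le_trans (norm2D _ _))// !norm2Z ?subr_ge0//.
have : (1 - l) * norm2 x <= (1 - l) * c by rewrite ler_wpM2l ?subr_ge0.
have : l * norm2 y <= l * c by rewrite ler_wpM2l.
lra.
Qed.

Lemma compact_cball2 (a : R) : compact (@cball2 R n a).
Proof.
apply: bounded_closed_compact.
  exists a; split; first exact: num_real.
  move=> b ab x xa; apply: norm_mx_le => [|i j].
    by rewrite (le_trans (norm2_ge0 x))// (le_trans xa)// ltW.
  by rewrite [i]ord1 (le_trans (norm2_entry _ _))// (le_trans xa)// ltW.
rewrite /cball2 (_ : [set x | _] = @norm2 R n @^-1` [set y | y <= a])//.
by apply: closed_comp; [move=> x _; exact: continuous_norm2|exact: closed_le].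
Qed.

End euclidean_norm.

(** * Integrals of matrix-valued functions *)

Section matrix_integral.
Variable R : realType.

Definition mx_integral (m k : nat) (g : R -> 'M[R]_(m, k)) (t : R) : 'M[R]_(m, k) :=
  \matrix_(i < m, j < k) \int[lebesgue_measure]_(s in `[0, t]) g s i j.

Lemma within_continuous_entry (A : set R) (m k : nat) (g : R -> 'M[R]_(m, k)) i j :
  {within A, continuous g} -> {within A, continuous (fun s => g s i j)}.
Proof.
move/subspace_continuousP => cg; apply/subspace_continuousP => s As.
by apply: cvg_mx_entry; exact: cg.
Qed.

Lemma integrable_itv0 (t T : R) (g : R -> R) : t \in `[0, T] ->
  {within `[0, T], continuous g} ->
  lebesgue_measure.-integrable `[0, t] (EFin \o g).
Proof.
rewrite in_itv/= => /andP[t0 tT] cg; apply: continuous_compact_integrable.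
  exact: segment_compact.
apply: continuous_subspaceW cg => s /=; rewrite !in_itv/= => /andP[-> st].
exact: le_trans tT.
Qed.

Lemma integral_expR (l t : R) : 0 < l -> 0 <= t ->
  \int[lebesgue_measure]_(s in `[0, t]) expR (l * s) = (expR (l * t) - 1) / l.
Proof.
move=> l0; rewrite le_eqVlt => /predU1P[<-|t0].
  by rewrite set_itv1 Rintegral_set1 mulr0 expR0 subrr mul0r.
have dE (s : R) : is_derive s 1 (fun s => l^-1 * expR (l * s)) (expR (l * s)).
  by apply: is_derive_eq; rewrite /GRing.scale/= !mulr1; field; rewrite gt_eqF.
have cE : continuous (fun s : R => l^-1 * expR (l * s)).
  move=> s; apply: differentiable_continuous; apply/derivable1_diffP.
  exact: (@ex_derive _ _ _ _ _ _ _ (dE s)).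
rewrite /Rintegral (@continuous_FTC2 _ _ (fun s => l^-1 * expR (l * s)))//.
- by rewrite /= mulr0 expR0; field; rewrite gt_eqF.
- apply: continuous_subspaceT => s.
  by apply: continuous_comp; [exact: mulrl_continuous|exact: continuous_expR].
- split; first by move=> s _; exact: (@ex_derive _ _ _ _ _ _ _ (dE s)).
  + by apply: cvg_at_right_filter; exact: cE.
  + by apply: cvg_at_left_filter; exact: cE.
- by move=> s _; rewrite derive1E; exact: (@derive_val _ _ _ _ _ _ _ (dE s)).
Qed.

Variables (m k : nat) (T : R).
Implicit Types (g h : R -> 'M[R]_(m, k)).

Lemma eq_mx_integral g h t : (forall s, s \in `[0, t] -> g s = h s) ->
  mx_integral g t = mx_integral h t.
Proof.
move=> gh; apply/matrixP => i j; rewrite !mxE; apply: eq_Rintegral => s.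
by rewrite inE/= => /gh ->.
Qed.

Lemma mx_integralB g h t : t \in `[0, T] ->
  {within `[0, T], continuous g} -> {within `[0, T], continuous h} ->
  mx_integral (fun s => g s - h s) t = mx_integral g t - mx_integral h t.
Proof.
move=> tT cg ch; apply/matrixP => i j; rewrite !mxE -RintegralB//.
- by apply: eq_Rintegral => s _; rewrite !mxE.
- by apply: (integrable_itv0 tT); exact: within_continuous_entry.
- by apply: (integrable_itv0 tT); exact: within_continuous_entry.
Qed.

Lemma mx_integral_continuous g : 0 <= T -> {within `[0, T], continuous g} ->
  {within `[0, T], continuous (mx_integral g)}.
Proof.
move=> T0 cg; apply/subspace_continuousP => s sT; apply: cvg_mxP => i j.
under eq_fun do rewrite mxE; rewrite mxE.
have ig : lebesgue_measure.-integrable `[0, T] (EFin \o (fun s => g s i j)).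
  apply: (@integrable_itv0 T); last exact: within_continuous_entry.
  by rewrite in_itv/= T0 lexx.
by have /subspace_continuousP := parameterized_integral_continuous T0 ig; exact.
Qed.

(** The weight [expR (l * s)] loses a factor [l] under integration: with [l]
    twice a Lipschitz constant, the integral operator halves weighted bounds
    on the whole of [[0, T]], however long that interval is. *)
Lemma norm_mx_integral g (c l t : R) : 0 < l -> t \in `[0, T] ->
  {within `[0, T], continuous g} ->
  (forall s, s \in `[0, T] -> `|g s| <= c * expR (l * s)) ->
  `|mx_integral g t| <= c / l * (expR (l * t) - 1).
Proof.
move=> l0 tT cg gc; have /andP[t0 tT'] : 0 <= t <= T by rewrite in_itv/= in tT.
have T0 : 0 <= T by exact: le_trans tT'.
have c0 : 0 <= c.
  have := gc 0; rewrite in_itv/= lexx T0 mulr0 expR0 mulr1 => /(_ isT).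
  exact: le_trans.
have cE : {within `[0, T], continuous (fun s => c * expR (l * s))}.
  apply: continuous_subspaceT => s; apply: cvgM; first exact: cvg_cst.
  by apply: continuous_comp; [exact: mulrl_continuous|exact: continuous_expR].
have cE' : {within `[0, T], continuous (fun s => expR (l * s))}.
  apply: continuous_subspaceT => s.
  by apply: continuous_comp; [exact: mulrl_continuous|exact: continuous_expR].
apply: norm_mx_le => [|i j].
  by rewrite mulr_ge0 ?divr_ge0 ?(ltW l0)// subr_ge0 -expR0 ler_expR mulr_ge0// ltW.
have ig : lebesgue_measure.-integrable `[0, t] (EFin \o (fun s => g s i j)).
  by apply: (integrable_itv0 tT); exact: within_continuous_entry.
rewrite mxE (le_trans (le_normr_Rintegral _ ig))//.
have -> : c / l * (expR (l * t) - 1) =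
    \int[lebesgue_measure]_(s in `[0, t]) (c * expR (l * s)).
  rewrite RintegralZl//; last exact: integrable_itv0 cE'.
  by rewrite integral_expR//; ring.
apply: le_Rintegral => //.
- exact: (integrable_abse ig).
- exact: integrable_itv0 cE.
- move=> s; rewrite /= in_itv/= => /andP[s0 st].
  rewrite (le_trans (norm_mx_entry _ _ _))// gc// in_itv/= s0/=.
  exact: le_trans tT'.
Qed.

End matrix_integral.

Lemma mulmx_integral (R : realType) (m k q : nat) (A : 'M[R]_(q, m)) (T : R)
    (g : R -> 'M[R]_(m, k)) t : t \in `[0, T] ->
  {within `[0, T], continuous g} ->
  A *m mx_integral g t = mx_integral (fun s => A *m g s) t.
Proof.
move=> tT cg; apply/matrixP => i j; rewrite !mxE.
under eq_Rintegral do rewrite mxE.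
have ig i' j' : {within `[0, T], continuous (fun s => g s i' j')}.
  exact: within_continuous_entry.
have cA (r : seq 'I_m) : {within `[0, T], continuous (fun s => \sum_(l <- r) A i l * g s l j)}.
  apply/subspace_continuousP => s sT.
  apply: (@cvg_big R _ +%R 0 _ (@add_continuous R) _ (within `[0, T] (nbhs s))) => l _.
  by apply: cvgM; [exact: cvg_cst|have /subspace_continuousP := ig l j; exact].
elim: (index_enum _) cA => [|l r IH] cA.
  by under eq_Rintegral do rewrite big_nil; rewrite big_nil Rintegral_cst// mul0r.
under eq_Rintegral do rewrite big_cons.
rewrite big_cons RintegralD//.
- rewrite IH// RintegralZl//.
  + by rewrite mxE.
  + exact: (integrable_itv0 tT).
- apply: (integrable_itv0 tT); apply/subspace_continuousP => s sT.
  by apply: cvgM; [exact: cvg_cst|have /subspace_continuousP := ig l j; exact].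
- exact: (integrable_itv0 tT).
Qed.

(** The maximum norm bounds an integral entry by entry, the Euclidean norm does
    not. Pairing the integral with itself reduces the estimate to the integral
    of a scalar function. *)
Lemma norm2_mx_integral (R : realType) (n : nat) (T : R) (g : R -> 'rV[R]_n) (M t : R) :
  t \in `[0, T] -> {within `[0, T], continuous g} ->
  (forall s, s \in `[0, T] -> norm2 (g s) <= M) ->
  norm2 (mx_integral g t) <= M * t.
Proof.
move=> tT cg gM; have /andP[t0 tT'] : 0 <= t <= T by rewrite in_itv/= in tT.
set v := mx_integral g t; have v0 := norm2_ge0 v.
have M0 : 0 <= M.
  apply: (le_trans (norm2_ge0 (g 0))); apply: gM; rewrite in_itv/= lexx/=.
  exact: le_trans tT'.
have [->|vn0] := eqVneq (norm2 v) 0; first by rewrite mulr_ge0.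
have vp : 0 < norm2 v by rewrite lt0r vn0.
rewrite -(ler_pM2l vp) -expr2 sqr_norm2.
have -> : dot v v = (v *m (mx_integral (fun s => (g s)^T) t)) 0 0.
  rewrite -mulmx_dot; congr ((v *m _) 0 0); apply/matrixP => i j; rewrite !mxE.
  by apply: eq_Rintegral => s _; rewrite mxE.
have cgT : {within `[0, T], continuous (fun s => (g s)^T)}.
  apply/subspace_continuousP => s sT; apply: cvg_mxP => i j; rewrite mxE.
  under eq_fun do rewrite mxE.
  by move/within_continuous_entry/subspace_continuousP : cg => /(_ j i s); exact.
have cvg' : {within `[0, T], continuous (fun s => v *m (g s)^T)}.
  apply/subspace_continuousP => s sT; apply: cvg_mulmx; first exact: cvg_cst.
  by move/subspace_continuousP : cgT; exact.
rewrite (mulmx_integral _ tT cgT) mxE.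
have -> : norm2 v * (M * t) = \int[lebesgue_measure]_(s in `[0, t]) (norm2 v * M).
  rewrite Rintegral_cst//= lebesgue_measure_itv/= lte_fin.
  case: ltP => t0'; first by rewrite /= oppr0 addr0 mulrA.
  by rewrite (@le_anti _ _ t 0) ?t0 ?t0'//= !mulr0.
apply: le_Rintegral => //.
- by apply: (integrable_itv0 tT); exact: within_continuous_entry.
- by apply: (integrable_itv0 tT); apply: continuous_subspaceT => s; exact: cvg_cst.
- move=> s; rewrite /= in_itv/= => /andP[s0 st].
  rewrite mulmx_dot (le_trans (dot_le _ _))// ler_pM2l// gM// in_itv/= s0/=.
  exact: le_trans tT'.
Qed.

(** * Limits of differentiable functions *)

Lemma diff_expansion (R : realType) (V W : normedModType R) (g : V -> W)
    (df : {linear V -> W}) (z : V) : continuous df ->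
  (forall e, 0 < e -> exists2 d, 0 < d &
    forall h, `|h| <= d -> `|g (z + h) - g z - df h| <= e * `|h|) ->
  differentiable g z /\ 'd g z = df :> (V -> W).
Proof.
move=> cdf gdf; have oE : g \o shift z = cst (g z) + df +o_ 0 id.
  apply/eqaddoP => e /gdf[d d0 gd]; apply/nbhs_norm0P; exists d => //= h /= hd.
  by have := gd h (ltW hd); rewrite [z + h]addrC !fctE/= opprD addrA.
have dE := diff_unique cdf oE.
by split=> //; apply/diff_locallyP; rewrite dE.
Qed.

Section limit_of_derivatives.
Variables (R : realType) (N m : nat).
Implicit Types (g : 'rV[R]_N -> 'rV[R]_m) (z h : 'rV[R]_N) (A : 'M[R]_(N, m)).

Lemma jacobian_unique g z A :
  (forall e, 0 < e -> exists2 d, 0 < d &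
    forall h, `|h| <= d -> `|g (z + h) - g z - h *m A| <= e * `|h|) ->
  differentiable g z /\ 'J g z = A.
Proof.
move=> gA.
have cA : continuous (mulmxr A : 'rV[R]_N -> 'rV[R]_m).
  by move=> h; apply: (@cvg_mulmx _ _ (nbhs h) _ _ _ _ id (cst A)) => //; exact: cvg_cst.
have [dg dB] := diff_expansion (df := mulmxr A) cA gA.
split=> //.
by apply/row_matrixP => i; rewrite !rowE /jacobian mul_rV_lin1 dB.
Qed.

(** If the first-order expansions of [g_ n] at [z] hold uniformly in [n], then
    pointwise convergence is enough: evaluating the expansions at the vectors
    [d *: delta_mx 0 i] of a small basis recovers the matrices [G_ n] from
    finitely many values of [g_ n], up to an error of relative size [e]. *)
Lemma jacobian_limit (g_ : nat -> 'rV[R]_N -> 'rV[R]_m) (G_ : nat -> 'M[R]_(N, m))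
    g z (d0 : R) : 0 < d0 ->
  (forall h, `|h| <= d0 -> g_ n (z + h) @[n --> \oo] --> g (z + h)) ->
  (forall e, 0 < e -> exists2 d, 0 < d & forall n h, `|h| <= d ->
    `|g_ n (z + h) - g_ n z - h *m G_ n| <= e * `|h|) ->
  differentiable g z /\ G_ n @[n --> \oo] --> 'J g z.
Proof.
move=> d0_gt0 g_g g_G.
have gz : g_ n z @[n --> \oo] --> g z.
  by have := g_g 0; rewrite addr0 normr0; apply; exact: ltW.
have cG : cvg (G_ n @[n --> \oo]).
  apply/cauchy_cvgP/cauchy_exP => e e0.
  have [d1 d1_gt0 gd] := g_G _ (divr_gt0 e0 (ltr0n R 8)).
  pose d := Num.min d0 d1; have d_gt0 : 0 < d by rewrite lt_min d0_gt0.
  pose b i : 'rV[R]_N := d *: delta_mx 0 i.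
  have bd i : `|b i| <= d.
    apply: norm_mx_le => [|k l]; first exact: ltW.
    rewrite !mxE; case: (_ && _); first by rewrite mulr1 gtr0_norm.
    by rewrite mulr0 normr0 ltW.
  have ed : 0 < e / 8 * d by rewrite mulr_gt0 ?divr_gt0.
  have near_z : \forall n \near \oo, `|g z - g_ n z| <= e / 8 * d.
    by move/cvgrPdist_le : gz; apply.
  have near_zb : \forall n \near \oo, forall i,
      `|g (z + b i) - g_ n (z + b i)| <= e / 8 * d.
    apply: filter_forall => i.
    suff /cvgrPdist_le : g_ n (z + b i) @[n --> \oo] --> g (z + b i) by apply.
    by apply: g_g; rewrite (le_trans (bd i))// ge_min lexx.
  have [n0 _ gn0] := filterI near_z near_zb.
  exists (G_ n0); exists n0 => // n /= n0n.
  rewrite -ball_normE/=; apply: (@le_lt_trans _ _ (6 / 8 * e)); last lra.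
  apply: norm_mx_le => [|i j]; first by rewrite mulr_ge0// ltW.
  have [z0 zb0] := gn0 n0 (leqnn _); have [z1 zb1] := gn0 n n0n.
  have bdd1 : `|b i| <= d1 by rewrite (le_trans (bd i))// ge_min lexx orbT.
  have H k : `|g_ k (z + b i) - g_ k z - b i *m G_ k| <= e / 8 * d.
    by rewrite (le_trans (gd k _ bdd1))// ler_pM2l ?divr_gt0.
  have bE : (b i *m (G_ n0 - G_ n)) 0 j = d * (G_ n0 - G_ n) i j.
    by rewrite -scalemxAl -rowE !mxE.
  rewrite -(ler_pM2l d_gt0) -{1}(gtr0_norm d_gt0) -normrM -bE.
  apply: le_trans (norm_mx_entry _ _ _) _.
  have -> : b i *m (G_ n0 - G_ n) =
    (g_ n (z + b i) - g_ n z - b i *m G_ n) - (g_ n0 (z + b i) - g_ n0 z - b i *m G_ n0)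
    + (g (z + b i) - g_ n (z + b i)) - (g (z + b i) - g_ n0 (z + b i))
    - (g z - g_ n z) + (g z - g_ n0 z).
    by rewrite mulmxBr; apply/matrixP => k l; rewrite !mxE; ring.
  have -> : d * (6 / 8 * e) = e / 8 * d + e / 8 * d + e / 8 * d + e / 8 * d
      + e / 8 * d + e / 8 * d by field.
  apply: le_trans (ler_normD _ _) _; apply: lerD; last exact: z0.
  apply: le_trans (ler_normB _ _) _; apply: lerD; last exact: z1.
  apply: le_trans (ler_normB _ _) _; apply: lerD; last exact: zb0.
  apply: le_trans (ler_normD _ _) _; apply: lerD; last exact: zb1.
  by apply: le_trans (ler_normB _ _) _; apply: lerD; exact: H.
have [A GA] : exists A, G_ n @[n --> \oo] --> A by exists (lim (G_ n @[n --> \oo])).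
have [|dg JA] := @jacobian_unique g z A; last by rewrite JA.
move=> e /g_G[d1 d1_gt0 gd].
exists (Num.min d0 d1); first by rewrite lt_min d0_gt0.
move=> h; rewrite le_min => /andP[hd0 hd1].
have c : `|g_ n (z + h) - g_ n z - h *m G_ n| @[n --> \oo] -->
    `|g (z + h) - g z - h *m A|.
  apply: cvg_norm; apply: cvgB; first by apply: cvgB gz; exact: g_g.
  by apply: cvg_mulmx GA; exact: cvg_cst.
by apply: (ler_cvg_to c (cvg_cst (e * `|h|))); apply: nearW => n; exact: gd.
Qed.

End limit_of_derivatives.

(** * Dependence of the Picard iterates on initial value and parameter *)

Section picard_dependence.
Variables (R : realType) (nx np : nat) (T a M L : R).
Variables (Q : set 'rV[R]_np) (p : 'rV[R]_np).
Variables (F : R -> 'rV[R]_(nx + np) -> 'rV[R]_nx).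
Variables (G : R -> 'rV[R]_(nx + np) -> 'M[R]_(nx + np, nx)).
Hypotheses (T_ge0 : 0 <= T) (L_gt0 : 0 < L).
Hypothesis F_continuous : forall v q, Ca a T v -> Q q ->
  {within `[0, T], continuous (fun s => F s (row_mx (v s) q))}.
Hypothesis G_continuous : forall v, Ca a T v ->
  {within `[0, T], continuous (fun s => G s (row_mx (v s) p))}.
Hypothesis F_le : forall s w q, s \in `[0, T] -> norm2 w <= a -> Q q ->
  norm2 (F s (row_mx w q)) <= M.
Hypothesis F_lip : forall s w w' q q', s \in `[0, T] ->
  norm2 w <= a -> norm2 w' <= a -> Q q -> Q q' ->
  `|F s (row_mx w' q') - F s (row_mx w q)| <=
    L * `|row_mx w' q' - row_mx w q|.
Hypothesis G_le : forall s w h, s \in `[0, T] -> norm2 w <= a ->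
  `|h *m G s (row_mx w p)| <= L * `|h : 'rV[R]_(nx + np)|.
Hypothesis F_diff : forall e, 0 < e -> exists2 d, 0 < d &
  forall s w w' q', s \in `[0, T] -> norm2 w <= a -> norm2 w' <= a -> Q q' ->
  `|row_mx w' q' - row_mx w p| <= d ->
  `|F s (row_mx w' q') - F s (row_mx w p)
      - (row_mx w' q' - row_mx w p) *m G s (row_mx w p)| <=
    e * `|row_mx w' q' - row_mx w p|.
Implicit Types (z h : 'rV[R]_(nx + np)) (u v : R -> 'rV[R]_nx) (s t : R).

(** The Picard operator with initial value and parameter stored side by side in
    the row vector [z]. *)
Definition joint_picard z u t : 'rV[R]_nx :=
  lsubmx z + mx_integral (fun s => F s (row_mx (u s) (rsubmx z))) t.

Definition joint_iter n z u : R -> 'rV[R]_nx := iter n (joint_picard z) u.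

(** A curve that starts at [lsubmx z] and moves with speed at most [M] stays in
    the ball of radius [a] up to time [T]. *)
Definition safe_start z : Prop := Q (rsubmx z) /\ norm2 (lsubmx z) + M * T <= a.

Lemma joint_iterS n z u : joint_iter n.+1 z u = joint_picard z (joint_iter n z u).
Proof. by []. Qed.

Lemma Ca_joint_iter n z u : safe_start z -> Ca a T u -> Ca a T (joint_iter n z u).
Proof.
move=> [Qz za] Cu; elim: n => [//|n IH]; rewrite joint_iterS.
have cF := F_continuous IH Qz; have [cI Ia] := IH.
split=> [|t tT].
  apply/subspace_continuousP => s sT; apply: cvgD; first exact: cvg_cst.
  by have /subspace_continuousP := mx_integral_continuous T_ge0 cF; exact.
apply: le_trans za; rewrite (le_trans (norm2D _ _))// lerD2l.
have /andP[t0 tT'] : 0 <= t <= T by rewrite in_itv/= in tT.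
have FM s : s \in `[0, T] ->
    norm2 (F s (row_mx (joint_iter n z u s) (rsubmx z))) <= M.
  by move=> sT; apply: F_le => //; exact: Ia.
rewrite (le_trans (norm2_mx_integral tT cF FM))// ler_wpM2l//.
apply: (le_trans (norm2_ge0 _) (FM 0 _)).
by rewrite in_itv/= lexx.
Qed.

Let weight s : R := expR (2 * L * s).

Let weight_ge1 s : 0 <= s -> 1 <= weight s.
Proof. by move=> s0; rewrite -expR0 ler_expR !mulr_ge0// ltW. Qed.

Let weight_le s : 0 <= s <= T -> weight s <= weight T.
Proof. by move=> /andP[_ sT]; rewrite ler_expR ler_pM2l// mulr_gt0. Qed.

Let norm_integral (m : nat) (g : R -> 'M[R]_(m, nx)) c t : 0 <= c -> t \in `[0, T] ->
  {within `[0, T], continuous g} ->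
  (forall s, s \in `[0, T] -> `|g s| <= L * (c * weight s)) ->
  `|mx_integral g t| <= c / 2 * (weight t - 1).
Proof.
move=> c0 tT cg gc; have l0 : 0 < 2 * L by rewrite mulr_gt0.
have -> : c / 2 = L * c / (2 * L) by field; rewrite gt_eqF.
by apply: (norm_mx_integral l0 tT cg) => s sT; rewrite -mulrA gc.
Qed.

(** The bound reproduces itself, uniformly in [n]: integration returns half of
    it, which leaves room for the difference of the initial values. *)
Lemma joint_iter_lip n z z' u t : safe_start z -> safe_start z' -> Ca a T u ->
  t \in `[0, T] ->
  `|joint_iter n z' u t - joint_iter n z u t| <= `|z' - z| * weight t.
Proof.
move=> sz sz' Cu; elim: n t => [|n IH] t tT.
  by rewrite subrr normr0 mulr_ge0// expR_ge0.
have t0 : 0 <= t by move: tT; rewrite in_itv/= => /andP[].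
have w1 := weight_ge1 t0.
have Cn := Ca_joint_iter n sz Cu; have Cn' := Ca_joint_iter n sz' Cu.
have cF := F_continuous Cn sz.1; have cF' := F_continuous Cn' sz'.1.
rewrite !joint_iterS /joint_picard opprD addrACA.
rewrite -(mx_integralB tT cF' cF) -linearB/=.
rewrite (le_trans (ler_normD _ _))//.
apply: (@le_trans _ _ (`|z' - z| + `|z' - z| / 2 * (weight t - 1))); last first.
  have := normr_ge0 (z' - z); nra.
rewrite lerD ?norm_lsubmx//; apply: norm_integral => //.
  apply/subspace_continuousP => s sT; apply: cvgB.
  + by move/subspace_continuousP : cF'; exact.
  + by move/subspace_continuousP : cF; exact.
move=> s sT; apply: le_trans (F_lip sT (Cn.2 _ sT) (Cn'.2 _ sT) sz.1 sz'.1) _.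
rewrite ler_pM2l// opp_row_mx add_row_mx; apply: norm_row_mx; first exact: IH.
rewrite -linearB/= (le_trans (norm_rsubmx _))// ler_peMr// weight_ge1//.
by move: sT; rewrite in_itv/= => /andP[].
Qed.

(** The derivative of the [n]th iterate in the joint variable. The recursion is
    the Picard iteration of the linearised equation along the iterates;
    [col_mx 0 1%:M] is the derivative of the parameter with respect to [z]. *)
Fixpoint iter_jacobian n z u : R -> 'M[R]_(nx + np, nx) :=
  if n is k.+1 then fun t =>
    col_mx 1%:M 0 + mx_integral (fun s =>
      row_mx (iter_jacobian k z u s) (col_mx 0 1%:M)
        *m G s (row_mx (joint_iter k z u s) (rsubmx z))) t
  else fun=> 0.

Lemma mul_state_jacobian h (J : 'M[R]_(nx + np, nx)) :
  h *m row_mx J (col_mx 0 1%:M) = row_mx (h *m J) (rsubmx h).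
Proof.
by rewrite mul_mx_row -{2}(hsubmxK h) mul_row_col mulmx0 add0r mulmx1.
Qed.

Let iter_jacobian_continuous n z u : safe_start z -> rsubmx z = p -> Ca a T u ->
  {within `[0, T], continuous (iter_jacobian n z u)} /\
  {within `[0, T], continuous (fun s =>
    row_mx (iter_jacobian n z u s) (col_mx 0 1%:M)
      *m G s (row_mx (joint_iter n z u s) (rsubmx z)))}.
Proof.
move=> sz zp Cu.
have step k : {within `[0, T], continuous (iter_jacobian k z u)} ->
    {within `[0, T], continuous (fun s =>
    row_mx (iter_jacobian k z u s) (col_mx 0 1%:M)
      *m G s (row_mx (joint_iter k z u s) (rsubmx z)))}.
  move=> cJ; apply/subspace_continuousP => s sT; apply: cvg_mulmx.
    by apply: cvg_row_mx; [move/subspace_continuousP : cJ; exact|exact: cvg_cst].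
  have := G_continuous (Ca_joint_iter k sz Cu).
  by rewrite zp => /subspace_continuousP; exact.
suff cJ : {within `[0, T], continuous (iter_jacobian n z u)}.
  by split=> //; exact: step.
elim: n => [|n IH]; first by apply: continuous_subspaceT => s; exact: cvg_cst.
apply/subspace_continuousP => s sT; apply: cvgD; first exact: cvg_cst.
by have /subspace_continuousP := mx_integral_continuous T_ge0 (step _ IH); exact.
Qed.

(** The size of the neighbourhood does not depend on [n]: the remainder of [F]
    is controlled through the bound of [joint_iter_lip], uniform in [n], and the
    error inherited from the previous iterate is halved in the weighted norm. *)
Lemma joint_iter_diff z u : safe_start z -> rsubmx z = p -> Ca a T u ->
  forall e, 0 < e -> exists2 d, 0 < d &
  forall n h t, `|h| <= d -> safe_start (z + h) -> t \in `[0, T] ->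
  `|joint_iter n (z + h) u t - joint_iter n z u t - h *m iter_jacobian n z u t|
    <= e * `|h| * weight t.
Proof.
move=> sz zp Cu e e0.
have [d d0 Fd] := F_diff (mulr_gt0 L_gt0 e0).
have wT0 : 0 < weight T by exact: expR_gt0.
exists (d / weight T); first exact: divr_gt0.
move=> n h t hd szh; elim: n t => [|n IH] t tT.
  by rewrite subrr mulmx0 subr0 normr0 !mulr_ge0// ?expR_ge0// ltW.
have t0 : 0 <= t by move: tT; rewrite in_itv/= => /andP[].
have Cn := Ca_joint_iter n sz Cu; have Cn' := Ca_joint_iter n szh Cu.
have cF := F_continuous Cn sz.1; have cF' := F_continuous Cn' szh.1.
have [_ cJG] := iter_jacobian_continuous n sz zp Cu.
set S := fun s => row_mx (joint_iter n z u s) (rsubmx z).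
set S' := fun s => row_mx (joint_iter n (z + h) u s) (rsubmx (z + h)).
set J := fun s => row_mx (iter_jacobian n z u s) (col_mx 0 1%:M).
have chJ : {within `[0, T], continuous (fun s => h *m (J s *m G s (S s)))}.
  apply/subspace_continuousP => s sT; apply: cvg_mulmx; first exact: cvg_cst.
  by move/subspace_continuousP : cJG; exact.
have cFF : {within `[0, T], continuous (fun s => F s (S' s) - F s (S s))}.
  apply/subspace_continuousP => s sT; apply: cvgB.
  + by move/subspace_continuousP : cF'; exact.
  + by move/subspace_continuousP : cF; exact.
have -> : joint_iter n.+1 (z + h) u t - joint_iter n.+1 z u t
      - h *m iter_jacobian n.+1 z u t =
    mx_integral (fun s => F s (S' s) - F s (S s) - h *m (J s *m G s (S s))) t.
  rewrite (mx_integralB tT cFF chJ) (mx_integralB tT cF' cF).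
  rewrite -(mulmx_integral _ tT cJG) !joint_iterS /joint_picard/= mulmxDr.
  have -> : h *m col_mx 1%:M 0 = lsubmx h.
    by rewrite -{1}(hsubmxK h) mul_row_col mulmx1 mulmx0 addr0.
  have E (A1 A2 A3 A4 A5 : 'rV[R]_nx) :
      A1 + A2 + A3 - (A1 + A4) - (A2 + A5) = A3 - A4 - A5.
    by apply/matrixP => k l; rewrite !mxE; ring.
  by rewrite linearD/= E.
have eh0 : 0 <= e * `|h| by rewrite mulr_ge0// ltW.
apply: (@le_trans _ _ (2 * (e * `|h|) / 2 * (weight t - 1))).
  apply: norm_integral => //; first by rewrite mulr_ge0.
    apply/subspace_continuousP => s sT; apply: cvgB.
    + by move/subspace_continuousP : cFF; exact.
    + by move/subspace_continuousP : chJ; exact.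
  move=> s sT; have s0 : 0 <= s <= T by rewrite in_itv/= in sT.
  have SS : `|S' s - S s| <= `|h| * weight s.
    rewrite opp_row_mx add_row_mx; apply: norm_row_mx.
      by have := joint_iter_lip n sz szh Cu sT; rewrite [z + h]addrC addrK.
    rewrite -linearB/= [z + h]addrC addrK (le_trans (norm_rsubmx _))// ler_peMr// weight_ge1//.
    by case/andP: s0.
  have -> : F s (S' s) - F s (S s) - h *m (J s *m G s (S s)) =
      (F s (S' s) - F s (S s) - (S' s - S s) *m G s (S s)) +
      (S' s - S s - h *m J s) *m G s (S s).
    by rewrite (mulmxBl (S' s - S s)) mulmxA addrA subrK.
  have SJ : `|S' s - S s - h *m J s| <= e * `|h| * weight s.
    rewrite mul_state_jacobian !opp_row_mx !add_row_mx; apply: norm_row_mx.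
      exact: IH.
    rewrite linearD/= [rsubmx z + _]addrC addrK subrr normr0.
    by rewrite !mulr_ge0// ?expR_ge0// ltW.
  have H1 : `|F s (S' s) - F s (S s) - (S' s - S s) *m G s (S s)| <=
      L * e * (`|h| * weight s).
    have H : `|F s (S' s) - F s (S s) - (S' s - S s) *m G s (S s)| <= L * e * `|S' s - S s|.
      rewrite /S zp; apply: Fd => //; [exact: Cn.2|exact: Cn'.2|exact: szh.1|].
      rewrite -zp (le_trans SS)//.
      apply: le_trans (ler_wpM2l (normr_ge0 h) (weight_le s0)) _.
      by rewrite -ler_pdivlMr.
    apply: le_trans H _; rewrite ler_pM2l// mulr_gt0//.
  have H2 : `|(S' s - S s - h *m J s) *m G s (S s)| <= L * (e * `|h| * weight s).
    rewrite /S zp; apply: (le_trans (G_le _ sT (Cn.2 _ sT))).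
    by rewrite ler_pM2l// -zp.
  rewrite (le_trans (ler_normD _ _))// (le_trans (lerD H1 H2))//; lra.
have -> : 2 * (e * `|h|) / 2 = e * `|h| by field.
by rewrite ler_wpM2l// gerBl.
Qed.

(** The distance to the fixed point [v] is halved by each iteration in the
    weighted norm; initially it is at most the diameter of the ball. *)
Lemma joint_iter_cvg z u v t : safe_start z -> Ca a T u -> Ca a T v ->
  (forall s, s \in `[0, T] -> v s = joint_picard z v s) -> t \in `[0, T] ->
  joint_iter n z u t @[n --> \oo] --> v t.
Proof.
move=> sz Cu Cv vP tT.
have a0 : 0 <= a by exact: le_trans (norm2_ge0 _) (Cu.2 _ tT).
have cv := F_continuous Cv sz.1.
have H n s : s \in `[0, T] ->
    `|joint_iter n z u s - v s| <= 2^-1 ^+ n * (a + a) * weight s.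
  elim: n s => [|n IH] s sT; have /andP[s0 _] : 0 <= s <= T by rewrite in_itv/= in sT.
    rewrite expr0 mul1r (@le_trans _ _ (a + a))//.
      apply: norm_mx_le; first exact: addr_ge0.
      move=> i j; rewrite [i]ord1 !mxE (le_trans (ler_normB _ _))// lerD//.
        exact: le_trans (norm2_entry _ _) (Cu.2 _ sT).
      exact: le_trans (norm2_entry _ _) (Cv.2 _ sT).
    by rewrite ler_peMr ?addr_ge0// weight_ge1.
  have Cn := Ca_joint_iter n sz Cu; have cF := F_continuous Cn sz.1.
  rewrite joint_iterS (vP _ sT) /joint_picard opprD addrACA subrr add0r.
  rewrite -(mx_integralB sT cF cv).
  set c := 2^-1 ^+ n * (a + a).
  have c0 : 0 <= c by rewrite mulr_ge0 ?addr_ge0// exprn_ge0// invr_ge0.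
  apply: (@le_trans _ _ (c / 2 * (weight s - 1))).
    apply: norm_integral => //.
      apply/subspace_continuousP => r rT; apply: cvgB.
      + by move/subspace_continuousP : cF; exact.
      + by move/subspace_continuousP : cv; exact.
    move=> r rT; apply: le_trans (F_lip rT (Cv.2 _ rT) (Cn.2 _ rT) sz.1 sz.1) _.
    have /andP[r0 _] : 0 <= r <= T by rewrite in_itv/= in rT.
    rewrite ler_pM2l// opp_row_mx add_row_mx; apply: norm_row_mx; first exact: IH.
    by rewrite subrr normr0 mulr_ge0// expR_ge0.
  have -> : 2^-1 ^+ n.+1 * (a + a) = c / 2 by rewrite exprSr /c mulrAC.
  by rewrite ler_wpM2l ?divr_ge0// gerBl.
apply/cvgrPdist_le => /= e e0.
have : 2^-1 ^+ n * ((a + a) * weight t) @[n --> \oo] --> 0 * ((a + a) * weight t).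
  apply: cvgM; last exact: cvg_cst.
  apply: cvg_expr; rewrite ger0_norm ?invr_ge0//.
  by rewrite invf_lt1// ltr1n.
rewrite mul0r => /cvgrPdist_le/(_ e e0); apply: filterS => n.
rewrite sub0r normrN => en; rewrite distrC (le_trans (H n t tT))//.
by rewrite -mulrA (le_trans (ler_norm _)).
Qed.

End picard_dependence.

(** * A continuously differentiable field near a compact set *)

Lemma segment_MVT (R : realType) (V : normedModType R) (m : nat)
    (g : V -> 'rV[R]_m) (x k : V) i :
  (forall l : R, 0 <= l <= 1 -> differentiable g (x + l *: k)) ->
  exists2 l : R, 0 <= l <= 1 & (g (x + k) - g x) 0 i = ('d g (x + l *: k) k) 0 i.
Proof.
move=> dg; pose c (l : R) := g (x + l *: k) 0 i.
have dc (l : R) : 0 <= l <= 1 -> is_derive l 1 c (('d g (x + l *: k) k) 0 i).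
  move=> l01; have dgl := dg l l01.
  have cc : h^-1 *: (c (h *: 1 + l) - c l) @[h --> 0^'] --> ('d g (x + l *: k) k) 0 i.
    have := @diff_derivable _ _ _ g _ k dgl; rewrite /derivable.
    have := deriveE k dgl; rewrite /derive => <- /cvg_mx_entry => /(_ 0 i).
    apply: cvg_trans; apply: near_eq_cvg; near=> h.
    rewrite !mxE /c -[h *: 1]/(h * 1) mulr1 scalerDl addrCA.
    by [].
  by apply: DeriveDef; [apply/cvg_ex; exists (('d g (x + l *: k) k) 0 i)|exact/cvg_lim].
have [||s s01] := @MVT_segment R c (fun l => ('d g (x + l *: k) k) 0 i) 0 1 ler01.
- by move=> l; rewrite in_itv/= => /andP[l0 l1]; apply: dc; rewrite !ltW.
- apply: derivable_within_continuous => l; rewrite in_itv/= => l01.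
  exact: (@ex_derive _ _ _ _ _ _ _ (dc l l01)).
rewrite subr0 mulr1 /c scale1r scale0r addr0 => sE.
by exists s; [move: s01; rewrite in_itv|rewrite !mxE sE].
Unshelve. all: by end_near. Qed.

Section smooth_field.
Variables (R : realType) (nx np : nat).
Variable f : R -> 'rV[R]_nx -> 'rV[R]_np -> 'rV[R]_nx.
Local Notation V := (R * 'rV[R]_nx * 'rV[R]_np)%type.
Implicit Types (z h k : 'rV[R]_(nx + np)).

Definition state_point (s : R) z : V := (s, lsubmx z, rsubmx z).

Definition state_dir z : V := (0, lsubmx z, rsubmx z).

Lemma state_dir_linear : linear state_dir.
Proof.
move=> c x y; rewrite /state_dir.
rewrite -[RHS]/(c * 0 + 0, c *: lsubmx x + lsubmx y, c *: rsubmx x + rsubmx y).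
by rewrite !linearP mulr0 addr0.
Qed.

HB.instance Definition _ :=
  GRing.isLinear.Build R 'rV[R]_(nx + np) V _ state_dir state_dir_linear.

Definition field (s : R) z : 'rV[R]_nx := f s (lsubmx z) (rsubmx z).

(** Directions have no time component: this is the part of the total derivative
    of [joint f] that belongs to the state and the parameter. *)
Definition field_diff (s : R) z h : 'rV[R]_nx :=
  'd (joint f) (state_point s z) (state_dir h).

Definition field_jacobian (s : R) z : 'M[R]_(nx + np, nx) :=
  \matrix_(i, j) field_diff s z (delta_mx 0 i) 0 j.

Lemma mul_field_jacobian s z h : h *m field_jacobian s z = field_diff s z h.
Proof.
rewrite -[RHS](mul_rV_lin1 ('d (joint f) (state_point s z) \o state_dir)).
by congr (_ *m _); apply/matrixP => i j; rewrite !mxE.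
Qed.

Variable U : set V.
Hypothesis C1 : forall x, U x -> differentiable (joint f) x /\
  forall v : V, {for x, continuous (fun y : V => 'd (joint f) y v)}.

Lemma cvg_state_point (T : Type) (F : set_system T) (FF : Filter F)
    (c : T -> R) (d : T -> 'rV[R]_(nx + np)) (s : R) z :
  c y @[y --> F] --> s -> d y @[y --> F] --> z ->
  state_point (c y) (d y) @[y --> F] --> state_point s z.
Proof.
move=> cs dz; have dl : lsubmx (d y) @[y --> F] --> lsubmx z.
  by apply: (cvg_comp _ _ dz); exact: continuous_lsubmx.
have dr : rsubmx (d y) @[y --> F] --> rsubmx z.
  by apply: (cvg_comp _ _ dz); exact: continuous_rsubmx.
exact: (cvg_pair (cvg_pair cs dl) dr).
Qed.

Lemma field_cvg (T : Type) (F : set_system T) (FF : Filter F)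
    (c : T -> R) (d : T -> 'rV[R]_(nx + np)) (s : R) z : U (state_point s z) ->
  c y @[y --> F] --> s -> d y @[y --> F] --> z ->
  field (c y) (d y) @[y --> F] --> field s z.
Proof.
move=> /C1[/differentiable_continuous cf _] cs dz.
exact: (cvg_comp _ _ (cvg_state_point FF cs dz) cf).
Qed.

Lemma field_diff_cvg (T : Type) (F : set_system T) (FF : Filter F)
    (c : T -> R) (d : T -> 'rV[R]_(nx + np)) (s : R) z h : U (state_point s z) ->
  c y @[y --> F] --> s -> d y @[y --> F] --> z ->
  field_diff (c y) (d y) h @[y --> F] --> field_diff s z h.
Proof.
move=> /C1[_ cf] cs dz.
exact: (cvg_comp _ _ (cvg_state_point FF cs dz) (cf (state_dir h))).
Qed.

Lemma field_jacobian_cvg (T : Type) (F : set_system T) (FF : Filter F)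
    (c : T -> R) (d : T -> 'rV[R]_(nx + np)) (s : R) z : U (state_point s z) ->
  c y @[y --> F] --> s -> d y @[y --> F] --> z ->
  field_jacobian (c y) (d y) @[y --> F] --> field_jacobian s z.
Proof.
move=> Uz cs dz; apply: cvg_mxP => i j; rewrite [X in _ --> X]mxE.
under eq_fun do rewrite mxE.
by apply: cvg_mx_entry; exact: field_diff_cvg.
Qed.

Lemma field_MVT s z k i :
  (forall l : R, 0 <= l <= 1 -> U (state_point s (z + l *: k))) ->
  exists2 l : R, 0 <= l <= 1 &
    (field s (z + k) - field s z) 0 i = (k *m field_jacobian s (z + l *: k)) 0 i.
Proof.
move=> Uz.
have E (l : R) : state_point s (z + l *: k) = state_point s z + l *: state_dir k.
  rewrite -[RHS]/(s + l * 0, lsubmx z + l *: lsubmx k, rsubmx z + l *: rsubmx k).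
  by rewrite mulr0 addr0 /state_point !linearD !linearZ.
have [|l l01 H] := @segment_MVT R V nx (joint f) (state_point s z) (state_dir k) i.
  by move=> l l01; rewrite -E; exact: (C1 (Uz l l01)).1.
exists l => //; rewrite mul_field_jacobian /field_diff E -H.
by have := E 1; rewrite !scale1r => <-.
Qed.

End smooth_field.

Section field_near_tube.
Variables (R : realType) (nx np : nat).
Variable f : R -> 'rV[R]_nx -> 'rV[R]_np -> 'rV[R]_nx.
Variable U : set (R * 'rV[R]_nx * 'rV[R]_np).
Hypothesis U_open : open U.
Hypothesis C1 : forall x, U x -> differentiable (joint f) x /\
  forall v : R * 'rV[R]_nx * 'rV[R]_np,
    {for x, continuous (fun y : R * 'rV[R]_nx * 'rV[R]_np => 'd (joint f) y v)}.
Variables (T a : R) (p : 'rV[R]_np).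
Hypothesis tube_U : forall (s : R) w, s \in `[0, T] -> norm2 w <= a ->
  U (state_point s (row_mx w p)).
Local Notation N := (nx + np)%N.
Implicit Types (z h k : 'rV[R]_N) (w : 'rV[R]_nx) (q : 'rV[R]_np).

(** By compactness of [[0, T]] times the ball, what holds near each state holds
    within a uniform distance. [P] sees the state and its displacement, so that
    it can compare the values of the field at the two. *)
Lemma near_tube (P : R -> 'rV[R]_N -> 'rV[R]_N -> Prop) :
  (forall (s : R) w, s \in `[0, T] -> norm2 w <= a ->
    \forall y \near ((s, w), 0 : 'rV[R]_N),
      P y.1.1 (row_mx y.1.2 p) (row_mx y.1.2 p + y.2)) ->
  exists2 d, 0 < d & forall k (s : R) w, `|k| <= d -> s \in `[0, T] -> norm2 w <= a ->
    P s (row_mx w p) (row_mx w p + k).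
Proof.
move=> nearP.
have /compact_near_coveringP cov : compact (`[0, T] `*` @cball2 R nx a).
  by apply: compact_setX; [exact: segment_compact|exact: compact_cball2].
have : \forall k \near (0 : 'rV[R]_N), `[0, T] `*` @cball2 R nx a `<=`
    (fun x => P x.1 (row_mx x.2 p) (row_mx x.2 p + k)).
  apply: (cov _ (nbhs (0 : 'rV[R]_N))
    (fun k x => P x.1 (row_mx x.2 p) (row_mx x.2 p + k))) => -[s w] [sT wa].
  exact: nearP.
move=> /nbhs_norm0P[d /= d0 dP]; exists (d / 2); first exact: divr_gt0.
move=> k s w kd sT wa; apply: (dP k _ (s, w)) => //=.
by rewrite (le_lt_trans kd)// ltr_pdivrMr// ltr_pMr// ltr1n.
Qed.

Let cvg_time (s : R) w : y.1.1 @[y --> ((s, w), 0 : 'rV[R]_N)] --> s.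
Proof. exact: (cvg_comp _ _ (@cvg_fst _ _ (nbhs (s, w)) (nbhs (0 : 'rV[R]_N)) _) cvg_fst). Qed.

Let cvg_pos (s : R) w : y.1.2 @[y --> ((s, w), 0 : 'rV[R]_N)] --> w.
Proof. exact: (cvg_comp _ _ (@cvg_fst _ _ (nbhs (s, w)) (nbhs (0 : 'rV[R]_N)) _) cvg_snd). Qed.

Let cvg_axis (s : R) w :
  row_mx y.1.2 p @[y --> ((s, w), 0 : 'rV[R]_N)] --> row_mx w p.
Proof. by apply: cvg_row_mx; [exact: cvg_pos|exact: cvg_cst]. Qed.

Let cvg_point (s : R) w :
  (row_mx y.1.2 p + y.2) @[y --> ((s, w), 0 : 'rV[R]_N)] --> row_mx w p.
Proof.
rewrite -[X in _ --> X]addr0; apply: cvgD; first exact: cvg_axis.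
exact: (@cvg_snd _ _ (nbhs (s, w)) (nbhs (0 : 'rV[R]_N)) _).
Qed.

Lemma tube_domain : exists2 d, 0 < d & forall k (s : R) w,
  `|k| <= d -> s \in `[0, T] -> norm2 w <= a -> U (state_point s (row_mx w p + k)).
Proof.
apply: (near_tube (P := fun s z z' => U (state_point s z'))) => s w sT wa.
have := cvg_state_point (nbhs_filter _) (@cvg_time s w) (@cvg_point s w).
by apply; apply: open_nbhs_nbhs; split=> //; exact: tube_U.
Qed.

Lemma tube_speed (M : R) :
  (forall (s : R) w, s \in `[0, T] -> norm2 w <= a -> norm2 (f s w p) < M) ->
  exists2 d, 0 < d & forall k (s : R) w, `|k| <= d -> s \in `[0, T] ->
    norm2 w <= a -> norm2 (field f s (row_mx w p + k)) <= M.
Proof.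
move=> fM.
apply: (near_tube (P := fun s z z' => norm2 (field f s z') <= M)) => s w sT wa.
have fF := field_cvg C1 (nbhs_filter _) (tube_U sT wa) (@cvg_time s w) (@cvg_point s w).
have /cvgr_lt := cvg_comp _ _ fF (@continuous_norm2 R nx _).
rewrite {1}/field row_mxKl row_mxKr => /(_ M (fM _ _ sT wa)).
by apply: filterS => y; exact: ltW.
Qed.

Lemma tube_jacobian_cont (e : R) : 0 < e ->
  exists2 d, 0 < d & forall k (s : R) w, `|k| <= d -> s \in `[0, T] -> norm2 w <= a ->
    `|field_jacobian f s (row_mx w p + k) - field_jacobian f s (row_mx w p)| <= e.
Proof.
move=> e0; apply: (near_tube (P := fun s z z' =>
  `|field_jacobian f s z' - field_jacobian f s z| <= e)) => s w sT wa.
have G1 := field_jacobian_cvg C1 (nbhs_filter _) (tube_U sT wa) (@cvg_time s w) (@cvg_point s w).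
have G2 := field_jacobian_cvg C1 (nbhs_filter _) (tube_U sT wa) (@cvg_time s w) (@cvg_axis s w).
have /cvgrPdist_le/(_ e e0) := cvgB (FF := nbhs_filter _) G1 G2.
have E (A B : 'M[R]_(N, nx)) : `|A - A - B| = `|B| by rewrite subrr sub0r normrN.
by apply: filterS => y H; rewrite -(E (field_jacobian f s (row_mx w p))).
Qed.

Lemma tube_jacobian_bounded : exists2 L, 0 < L & exists2 d, 0 < d &
  forall k (s : R) w, `|k| <= d -> s \in `[0, T] -> norm2 w <= a ->
    `|field_jacobian f s (row_mx w p + k)| <= L.
Proof.
have /compact_near_coveringP cov : compact (`[0, T] `*` @cball2 R nx a).
  by apply: compact_setX; [exact: segment_compact|exact: compact_cball2].
have : \forall L \near +oo, `[0, T] `*` @cball2 R nx a `<=`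
    (fun x => `|field_jacobian f x.1 (row_mx x.2 p)| <= L).
  apply: (cov _ +oo
    (fun L x => `|field_jacobian f x.1 (row_mx x.2 p)| <= L)) => -[s w] [sT wa].
  have cw : row_mx y.2 p @[y --> (s, w)] --> row_mx w p.
    by apply: cvg_row_mx; [exact: cvg_snd|exact: cvg_cst].
  have lt1 : `|field_jacobian f s (row_mx w p)| < `|field_jacobian f s (row_mx w p)| + 1.
    by rewrite -[ltLHS]addr0 ler_ltD.
  have cs : y.1 @[y --> (s, w)] --> s by exact: cvg_fst.
  have := field_jacobian_cvg C1 (nbhs_filter (s, w)) (tube_U sT wa) cs cw.
  move=> /cvg_norm/cvgr_lt/(_ _ lt1) H.
  exists ([set x | `|field_jacobian f x.1 (row_mx x.2 p)|
      < `|field_jacobian f s (row_mx w p)| + 1],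
    [set L | `|field_jacobian f s (row_mx w p)| + 1 <= L]).
    by split=> //; exact: nbhs_pinfty_ge.
  by move=> [y L] /= [/ltW yG]; exact: le_trans.
move=> [L0 [_ H]]; pose L := Num.max (L0 + 1) 1.
have L1 : 0 < L by rewrite lt_max ltr01 orbT.
have [d d0 dG] := tube_jacobian_cont ltr01.
exists (1 + L); first exact: addr_gt0.
exists d => // k s w kd sT wa.
rewrite -[field_jacobian _ _ _](subrK (field_jacobian f s (row_mx w p))).
rewrite (le_trans (ler_normD _ _))// lerD ?dG//.
by apply: (H L _ (s, w)) => //; rewrite lt_max ltrDl ltr01.
Qed.

Lemma tube_segment (r l : R) w w' q q' : 0 <= l <= 1 ->
  norm2 w <= a -> norm2 w' <= a -> `|q - p| <= r -> `|q' - p| <= r ->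
  exists v k, [/\ norm2 v <= a, `|k| <= r &
    row_mx w q + l *: (row_mx w' q' - row_mx w q) = row_mx v p + k].
Proof.
move=> l01 wa wa' qr qr'; have /andP[l0 l1] := l01.
exists (w + l *: (w' - w)), (row_mx 0 ((1 - l) *: (q - p) + l *: (q' - p))); split.
- exact: norm2_convex.
- apply: norm_row_mx; first by rewrite normr0 (le_trans _ qr).
  rewrite (le_trans (ler_normD _ _))// !normrZ !ger0_norm ?subr_ge0//.
  have : (1 - l) * `|q - p| <= (1 - l) * r by rewrite ler_wpM2l ?subr_ge0.
  have : l * `|q' - p| <= l * r by rewrite ler_wpM2l.
  lra.
- rewrite opp_row_mx add_row_mx scale_row_mx !add_row_mx addr0; congr row_mx.
  by apply/matrixP => i j; rewrite !mxE; ring.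
Qed.

Lemma tube_lip (r L : R) : 0 <= L ->
  (forall k (s : R) w, `|k| <= r -> s \in `[0, T] -> norm2 w <= a ->
    U (state_point s (row_mx w p + k)) /\
    `|field_jacobian f s (row_mx w p + k)| <= L) ->
  forall (s : R) w w' q q', s \in `[0, T] -> norm2 w <= a -> norm2 w' <= a ->
    `|q - p| <= r -> `|q' - p| <= r ->
  `|field f s (row_mx w' q') - field f s (row_mx w q)| <=
    N%:R * L * `|row_mx w' q' - row_mx w q|.
Proof.
move=> L0 UL s w w' q q' sT wa wa' qr qr'.
apply: norm_mx_le => [|i j]; first by rewrite !mulr_ge0.
have [|l l01] := @field_MVT R nx np f U C1 s (row_mx w q) (row_mx w' q' - row_mx w q) j.
  move=> l l01; have [v [k [va kr ->]]] := tube_segment l01 wa wa' qr qr'.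
  exact: (UL k s v kr sT va).1.
rewrite [i]ord1 subrKC => ->.
rewrite (le_trans (norm_mx_entry _ _ _))// (le_trans (norm_mulmx _ _))//.
rewrite mulrAC ler_wpM2r// ler_wpM2l//.
have [v [k [va kr ->]]] := tube_segment l01 wa wa' qr qr'.
exact: (UL k s v kr sT va).2.
Qed.

(** Along the segment between the two states the Jacobian varies by at most
    [e], so that by the mean value theorem the increment of [field f] differs
    from the value of its differential at one end by a fraction of order [e]. *)
Lemma tube_diff (r : R) :
  (forall k (s : R) w, `|k| <= r -> s \in `[0, T] -> norm2 w <= a ->
    U (state_point s (row_mx w p + k))) ->
  forall e, 0 < e -> exists2 d, 0 < d &
  forall (s : R) w w' q', s \in `[0, T] -> norm2 w <= a -> norm2 w' <= a ->
    `|q' - p| <= r -> `|row_mx w' q' - row_mx w p| <= d ->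
  `|field f s (row_mx w' q') - field f s (row_mx w p)
      - (row_mx w' q' - row_mx w p) *m field_jacobian f s (row_mx w p)| <=
    e * `|row_mx w' q' - row_mx w p|.
Proof.
move=> UL e e0; have N0 : 0 < N.+1%:R :> R by rewrite ltr0n.
have [d d0 dG] := tube_jacobian_cont (divr_gt0 e0 N0).
exists d => // s w w' q' sT wa wa' qr'; set k := row_mx w' q' - row_mx w p => kd.
apply: norm_mx_le => [|i j]; first by rewrite mulr_ge0// ltW.
have pr : `|p - p| <= r by rewrite subrr normr0 (le_trans _ qr').
have [|l l01] := @field_MVT R nx np f U C1 s (row_mx w p) k j.
  move=> l l01; have [v [k' [va kr ->]]] := tube_segment l01 wa wa' pr qr'.
  exact: UL.
rewrite subrKC => H.
have {H} -> : (field f s (row_mx w' q') - field f s (row_mx w p)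
      - k *m field_jacobian f s (row_mx w p)) i j =
    (k *m (field_jacobian f s (row_mx w p + l *: k)
      - field_jacobian f s (row_mx w p))) 0 j.
  by rewrite [i]ord1 mulmxBr [LHS]mxE H [RHS]mxE.
have lk : `|l *: k| <= d.
  rewrite normrZ (le_trans _ kd)// ler_piMl// ger0_norm; by case/andP: l01.
rewrite (le_trans (norm_mx_entry _ _ _))// (le_trans (norm_mulmx _ _))//.
apply: (@le_trans _ _ (N%:R * `|k| * (e / N.+1%:R))).
  by rewrite ler_wpM2l ?mulr_ge0// dG.
have -> : N%:R * `|k| * (e / N.+1%:R) = N%:R / N.+1%:R * (e * `|k|) by ring.
rewrite ler_piMl ?mulr_ge0 ?(ltW e0)// ler_pdivrMr// mul1r ler_nat//.
Qed.

End field_near_tube.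

(** * Solutions of the differential equation *)

Section solution.
Variables (R : realType) (n : nat) (T : R).
Variables (v g : R -> 'rV[R]_n).
Hypothesis T_gt0 : 0 < T.
Hypothesis v_deriv : forall t, t \in `[0, T] ->
  h^-1 *: (v (t + h) - v t) @[h --> within [set h : R | t + h \in `[0, T]] 0^'] --> g t.

Lemma solution_continuous : {within `[0, T], continuous v}.
Proof.
apply/subspace_continuousP => t /= tT.
have /cvgrPdist_le/(_ 1 ltr01) H0 := v_deriv tT.
have : \forall h \near (0 : R), h != 0 -> t + h \in `[0, T] ->
  `|g t - h^-1 *: (v (t + h) - v t)| <= 1 by exact: H0.
move=> /nbhs_norm0P[d /= d0 H].
pose c := `|g t| + 1; have c0 : 0 < c by rewrite ltr_wpDl.
apply/cvgrPdist_le => /= e e0; rewrite near_withinE.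
have : \forall s \near t, `|s - t| < Num.min d (e / c).
  have m0 : 0 < Num.min d (e / c) by rewrite lt_min d0 divr_gt0.
  have /cvgrPdist_lt/(_ _ m0) : s @[s --> t] --> t by exact: cvg_id.
  by apply: filterS => s; rewrite distrC.
apply: filterS => s; rewrite lt_min => /andP[sd se] sT.
have [->|st] := eqVneq s t; first by rewrite subrr normr0 ltW.
have st0 : s - t != 0 by rewrite subr_eq0.
have := H (s - t) sd st0; rewrite subrKC => /(_ sT) B.
have Q : `|(s - t)^-1 *: (v s - v t)| <= c.
  rewrite -[_ *: _](subrK (g t)) (le_trans (ler_normD _ _))// addrC lerD2l.
  by rewrite distrC.
rewrite distrC -[v s - v t](scalerKV st0) normrZ.
rewrite (le_trans (ler_wpM2l (normr_ge0 _) Q))// -ler_pdivlMr//.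
exact: ltW.
Qed.

Lemma solution_is_derive t i : t \in `]0, T[ ->
  is_derive t 1 (fun s => v s 0 i) (g t 0 i).
Proof.
move=> tT; have tT' : t \in `[0, T] by exact: subset_itv_oo_cc tT.
have c : h^-1 *: (v (h *: 1 + t) 0 i - v t 0 i) @[h --> 0^'] --> g t 0 i.
  have c := @cvg_mx_entry R R _ _ 1 n _ _ 0 i (v_deriv tT').
  move=> A /c.
  rewrite /= => H0.
  have H : \forall h \near 0^', t + h \in `[0, T] ->
    A ((h^-1 *: (v (t + h) - v t)) 0 i) by exact: H0.
  have : \forall h \near 0^', t + h \in `[0, T].
    apply: nbhs_dnbhs; have /nbhs0P := near_in_itvoo tT.
    by apply: filterS => h; exact: subset_itv_oo_cc.
  apply: filterS2 H => h H hT; have := H hT.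
  have E : h *: 1 + t = t + h :> R by rewrite addrC; congr (_ + _); exact: mulr1.
  by rewrite -E !mxE.
by apply: DeriveDef; [apply/cvg_ex; exists (g t 0 i)|exact/cvg_lim].
Qed.

Lemma solution_eq_integral : {within `[0, T], continuous g} ->
  forall t, t \in `[0, T] -> v t = v 0 + mx_integral g t.
Proof.
move=> cg t tT; have /andP[t0 tT'] : 0 <= t <= T by rewrite in_itv/= in tT.
apply/matrixP => i j; rewrite [i]ord1 !mxE; move: t0; rewrite le_eqVlt => /predU1P[<-|t0].
  by rewrite set_itv1 Rintegral_set1 addr0.
have sub : `[0, t] `<=` `[0, T].
  by move=> s /=; rewrite !in_itv/= => /andP[-> /le_trans]; apply.
rewrite /Rintegral (@continuous_FTC2 _ _ (fun s => v s 0 j))//.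
- by rewrite /= addrC subrK.
- by apply: (continuous_subspaceW sub); exact: within_continuous_entry.
- have /(continuous_within_itvP _ t0)[_ c0 ct] :
      {within `[0, t], continuous (fun s => v s 0 j)}.
    apply: (continuous_subspaceW sub); apply: within_continuous_entry.
    exact: solution_continuous.
  split=> // s sT; apply: (@ex_derive _ _ _ _ _ _ _ (@solution_is_derive s j _)).
  by move: sT; rewrite !in_itv/= => /andP[-> /lt_le_trans]; apply.
- move=> s sT; rewrite derive1E; apply: (@derive_val _ _ _ _ _ _ _ (@solution_is_derive s j _)).
  by move: sT; rewrite !in_itv/= => /andP[-> /lt_le_trans]; apply.
Qed.

Variables (a M : R).
Hypothesis M_ge0 : 0 <= M.
Hypothesis v_start : norm2 (v 0) + M * T < a.
Hypothesis g_le : forall s, s \in `[0, T] -> norm2 (v s) <= a -> norm2 (g s) <= M.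

(** As long as the curve has not left the ball its speed is at most [M], so the
    mean value theorem for its component along the chord bounds the chord. *)
Let solution_in_ball t : t \in `[0, T] ->
  (forall s, s \in `]0, t[ -> norm2 (v s) <= a) -> norm2 (v t) < a.
Proof.
move=> tT va; have /andP[t0 tT'] : 0 <= t <= T by rewrite in_itv/= in tT.
apply: le_lt_trans v_start; set e := v t - v 0.
rewrite -[v t](subrK (v 0)) addrC (le_trans (norm2D _ _))// lerD2l -/e.
move: t0; rewrite le_eqVlt => /predU1P[t0|t0].
  have n0 : norm2 (0 : 'rV[R]_n) = 0.
    by rewrite /norm2 big1 ?sqrtr0// => i _; rewrite mxE expr0n.
  by rewrite /e -t0 subrr n0 mulr_ge0// ltW.
have sub : `[0, t] `<=` `[0, T].
  by move=> s /=; rewrite !in_itv/= => /andP[-> /le_trans]; apply.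
have cE (s : R) : s \in `]0, t[ -> is_derive s 1 (fun s => dot e (v s)) (dot e (g s)).
  move=> sT; have sT' : s \in `]0, T[.
    by move: sT; rewrite !in_itv/= => /andP[-> /lt_le_trans]; apply.
  have D := is_derive_sum (fun i => is_deriveZ (e 0 i) (solution_is_derive i sT')).
  have E : (fun s => dot e (v s)) = \sum_(i < n) (e 0 i \*: (fun s => v s 0 i)).
    by apply/funext => r; rewrite fct_sumE.
  by rewrite E; exact: D.
have [|c ct] := MVT t0 cE.
  apply/subspace_continuousP => s sT.
  apply: (@cvg_big R _ +%R 0 _ (@add_continuous R) _ (within `[0, t] (nbhs s))) => i _.
  apply: cvgM; first exact: cvg_cst.
  suff /subspace_continuousP : {within `[0, t], continuous (fun s => v s 0 i)} by apply.
  apply: (continuous_subspaceW sub); apply: within_continuous_entry.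
  exact: solution_continuous.
have -> : dot e (v t) - dot e (v 0) = norm2 e ^+ 2.
  by rewrite sqr_norm2 -sumrB; apply: eq_bigr => i _; rewrite -mulrBr !mxE.
rewrite subr0 => H.
have cT : c \in `[0, T].
  by move: ct; rewrite !in_itv/= => /andP[/ltW-> /ltW/le_trans]; apply.
have [->|e0] := eqVneq (norm2 e) 0; first by rewrite mulr_ge0// ltW.
have ep : 0 < norm2 e by rewrite lt0r e0 norm2_ge0.
rewrite -(ler_pM2l ep) -expr2 H mulrA.
have gM : dot e (g c) <= norm2 e * M.
  by rewrite (le_trans (dot_le _ _))// ler_pM2l// g_le// va.
by rewrite (le_trans (ler_wpM2r (ltW t0) gM))// ler_wpM2l// mulr_ge0// ltW.
Qed.

(** At the last time [b] up to which the curve is in the ball it is strictly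
    inside, hence it stays inside a little longer, unless [b = T]. *)
Lemma solution_stays t : t \in `[0, T] -> norm2 (v t) <= a.
Proof.
pose E := [set t | t \in `[0, T] /\ forall s, s \in `[0, t] -> norm2 (v s) <= a].
have a0 : norm2 (v 0) <= a.
  by rewrite (le_trans _ (ltW v_start))// lerDl mulr_ge0// ltW.
have E0 : E 0.
  split; first by rewrite in_itv/= lexx ltW.
  by move=> s; rewrite in_itv/= => s0; rewrite -(@le_anti _ _ 0 s).
have supE : has_sup E.
  by split; [exists 0|exists T => s [+ _]; rewrite in_itv/= => /andP[]].
pose b := sup E.
have b0 : 0 <= b by exact: sup_upper_bound.
have bT : b <= T by apply: ge_sup => [|s [+ _]]; [exists 0|rewrite in_itv/= => /andP[]].
have bI : b \in `[0, T] by rewrite in_itv/= b0.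
have below s : 0 <= s < b -> norm2 (v s) <= a.
  move=> /andP[s0 sb]; have bs : 0 < b - s by rewrite subr_gt0.
  have [y [yT ya]] := sup_adherent bs supE; rewrite subKr => sy.
  by apply: ya; rewrite in_itv/= s0 ltW.
have vb : norm2 (v b) < a.
  by apply: solution_in_ball => // s; rewrite in_itv/= => /andP[/ltW s0 sb]; rewrite below ?s0.
have : \forall s \near within `[0, T] (nbhs b), norm2 (v s) < a.
  have /subspace_continuousP/(_ b bI) cv := solution_continuous.
  have /cvgr_lt := cvg_comp _ _ cv (@continuous_norm2 R n _).
  by apply.
rewrite near_withinE => /nbhs_normP[d /= d0 db].
have bE : T <= b.
  rewrite leNgt; apply/negP => bltT.
  pose b' := Num.min T (b + d / 2).
  have bb' : b < b' by rewrite lt_min bltT ltrDl divr_gt0.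
  suff Eb' : E b' by have := sup_upper_bound supE Eb'; rewrite leNgt bb'.
  split; first by rewrite in_itv/= (le_trans b0 (ltW bb')) ge_min lexx.
  move=> s; rewrite in_itv/= le_min => /andP[s0 /andP[sT sd]].
  have [sb|bs] := ltP s b; first by rewrite below// s0.
  apply/ltW/db; last by rewrite /= in_itv/= s0.
  rewrite /= ler0_norm ?subr_le0// opprB.
  by rewrite ltrBlDl (le_lt_trans sd)// ltrD2l ltr_pdivrMr// ltr_pMr// ltr1n.
rewrite in_itv/= => /andP[t0 tT].
have : t <= b by exact: le_trans bE.
by rewrite le_eqVlt => /predU1P[->|tb]; [exact: ltW|rewrite below// t0].
Qed.

End solution.

(** * The Picard iterates of the initial value problem *)

Lemma norm2_le_half (R : realType) (n : nat) (X : set 'rV[R]_n) x :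
  compact X -> X x -> norm2 x <= twice_sup_norm2 X / 2.
Proof.
move=> cX Xx; rewrite /twice_sup_norm2 mulrAC divff// mul1r.
apply: sup_upper_bound; last by exists x.
split; first by exists (norm2 x), x.
have [B [_ XB]] : bounded_set (@norm2 R n @` X).
  apply: compact_bounded; apply: continuous_compact => //.
  by apply: continuous_subspaceT; exact: continuous_norm2.
exists (B + 1) => y Xy; rewrite (le_trans (ler_norm y))// (XB (B + 1))//.
by rewrite ltrDl.
Qed.

(** The supremum [Mf] is finite, since [a / +oo = 0] would contradict [0 < T].
    If [Mf = 0] the quotient is [+oo] unless [a = 0], so that the bound on [T]
    still excludes [a = 0] and the inequality for [M] stays strict. *)
Lemma horizon_speed (R : realType) (nx np : nat)
    (f : R -> 'rV[R]_nx -> 'rV[R]_np -> 'rV[R]_nx) (Gam : set R)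
    (Theta : set 'rV[R]_np) (a T s0 : R) (p0 : 'rV[R]_np) : 0 <= a -> 0 < T ->
  Gam s0 -> Theta p0 -> (T%:E < a%:E / (2%:E * Mf f Gam Theta a))%E ->
  exists M, [/\ 0 <= M, M * T < a / 2 &
    forall s w p, Gam s -> Theta p -> norm2 w <= a -> norm2 (f s w p) <= M].
Proof.
move=> a0 T0 Gs Tp Tlt.
have ub s w p : Gam s -> Theta p -> norm2 w <= a ->
    ((norm2 (f s w p))%:E <= Mf f Gam Theta a)%E.
  by move=> Gs' Tp' wa; apply: ereal_sup_ubound; exists s, w, p.
have n0 : norm2 (0 : 'rV[R]_nx) <= a.
  by rewrite /norm2 big1 ?sqrtr0// => i _; rewrite mxE expr0n.
move: Tlt ub; case: (Mf f Gam Theta a) => [M| |] Tlt ub.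
- have M0 : 0 <= M.
    by have := ub s0 0 p0 Gs Tp n0; rewrite lee_fin; apply: le_trans; exact: norm2_ge0.
  have fM s w p : Gam s -> Theta p -> norm2 w <= a -> norm2 (f s w p) <= M.
    by move=> Gs' Tp' wa; have := ub s w p Gs' Tp' wa; rewrite lee_fin.
  exists M; split=> //.
  have [M00|M00] := eqVneq M 0.
    move: Tlt; rewrite M00 mul0r -EFinM mulr0 inve0.
    have [->|an0 _] := eqVneq a 0; first by rewrite mul0e lte_fin ltNge ltW.
    by rewrite divr_gt0// lt0r an0.
  have Mp : 0 < M by rewrite lt0r M00.
  move: Tlt; rewrite -EFinM inver mulf_eq0 (negPf M00) pnatr_eq0/= -EFinM lte_fin.
  by rewrite invfM mulrA ltr_pdivlMr// mulrC.
- have yE : (2%:E * +oo = +oo :> \bar R)%E by rewrite gt0_muley// lte_fin.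
  by move: Tlt; rewrite yE invey mule0 lte_fin ltNge ltW.
- by have := ub s0 0 p0 Gs Tp n0; rewrite leNgt ltNyr.
Qed.

Lemma joint_iterE (R : realType) (nx np : nat)
    (f : R -> 'rV[R]_nx -> 'rV[R]_np -> 'rV[R]_nx) n z u :
  joint_iter (field f) n z u = picard_iter f n 0 (lsubmx z) (rsubmx z) u.
Proof.
elim: n => [//|n IH]; rewrite joint_iterS IH; apply/funext => t.
rewrite /picard_iter/= -/(picard_iter f n 0 (lsubmx z) (rsubmx z) u) /joint_picard /picard.
congr (_ + _); apply/rowP => i; rewrite !mxE; apply: eq_Rintegral => s _.
by rewrite addr0 /field row_mxKl row_mxKr.
Qed.

Theorem proposition13 (R : realType) (nx np : nat)
  (Gam : set R) (X : set 'rV[R]_nx) (Theta : set 'rV[R]_np)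
  (cGam : compact Gam) (cX : compact X) (cTheta : compact Theta)
  (f : R -> 'rV[R]_nx -> 'rV[R]_np -> 'rV[R]_nx)
  (fC1 : C1_on (Gam `*` [set: 'rV[R]_nx] `*` Theta) (joint f))
  (f_lip : [locally [lipschitz joint f z
              | z in Gam `*` [set: 'rV[R]_nx] `*` Theta]])
  (gradx_lip : [locally [lipschitz joint (grad_x f) z
              | z in Gam `*` [set: 'rV[R]_nx] `*` Theta]])
  (gradp_lip : [locally [lipschitz joint (grad_p f) z
              | z in Gam `*` [set: 'rV[R]_nx] `*` Theta]])
  (a : R) (aE : a = twice_sup_norm2 X)
  (T : R) (T_gt0 : 0 < T)
  (T_lt : (T%:E < Order.min (Kx f Gam Theta a)^-1
                            (a%:E / (2%:E * Mf f Gam Theta a)))%E)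
  (TGam : `[0, T] `<=` Gam)
  (phi : R -> 'rV[R]_nx -> 'rV[R]_np -> 'rV[R]_nx)
  (D : set ('rV[R]_nx * 'rV[R]_np)) (oD : open D) (XThetaD : X `*` Theta `<=` D)
  (phi_sol : solution_map f T D phi)
  (u : R -> 'rV[R]_nx) (uCa : Ca a T u)
  (t : R) (x : 'rV[R]_nx) (p : 'rV[R]_np)
  (tT : t \in `[0, T]) (xX : X x) (pTheta : Theta p) :
  [/\ forall n : nat,
        differentiable_xp (fun y q => picard_iter f n 0 y q u t) x p,
      differentiable_xp (phi t) x p &
      grad_xp (fun y q => picard_iter f n 0 y q u t) x p @[n --> \oo]
        --> grad_xp (phi t) x p].
Proof.
have [U [oU subU C1]] := fC1.
have xa : norm2 x <= a / 2 by rewrite aE; exact: norm2_le_half.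
have a0 : 0 <= a by have := le_trans (norm2_ge0 x) xa; rewrite ler_pdivlMr// mul0r.
have T0 : 0 \in `[0, T] by rewrite in_itv/= lexx ltW.
have [M0 [M0_ge0 M0T fM0]] : exists M, [/\ 0 <= M, M * T < a / 2 &
    forall s w q, Gam s -> Theta q -> norm2 w <= a -> norm2 (f s w q) <= M].
  apply: (horizon_speed a0 T_gt0 (TGam _ T0) pTheta).
  by move: T_lt; rewrite lt_min => /andP[].
(* For parameters outside [Theta] the speed may exceed [M0]; any [M] strictly
   between [M0] and [a / 2 / T] leaves room for that. *)
pose M := (M0 + a / 2 / T) / 2.
have M0M : M0 < M by rewrite midf_lt// ltr_pdivlMr.
have MT : M * T < a / 2 by rewrite -ltr_pdivlMr// midf_lt// ltr_pdivlMr.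
have M_ge0 : 0 <= M by rewrite (le_trans M0_ge0)// ltW.
have tube_U (s : R) w : s \in `[0, T] -> norm2 w <= a -> U (state_point s (row_mx w p)).
  move=> sT wa; apply: subU; rewrite /state_point row_mxKl row_mxKr.
  by split=> //; split=> //; exact: TGam.
have [d1 d1_gt0 dU] := tube_domain oU tube_U.
have [d2 d2_gt0 dM] : exists2 d, 0 < d & forall k (s : R) w, `|k| <= d -> s \in `[0, T] ->
    norm2 w <= a -> norm2 (field f s (row_mx w p + k)) <= M.
  apply: (tube_speed C1 tube_U) => s w sT wa.
  by apply: le_lt_trans M0M; apply: fM0 => //; exact: TGam.
have [L L_gt0 [d3 d3_gt0 dL]] := tube_jacobian_bounded C1 tube_U.
pose r := Num.min d1 (Num.min d2 d3).
have r_gt0 : 0 < r by rewrite !lt_min d1_gt0 d2_gt0.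
have {}dU k (s : R) w : `|k| <= r -> s \in `[0, T] -> norm2 w <= a ->
    U (state_point s (row_mx w p + k)).
  by rewrite !le_min => /andP[kd _]; exact: dU.
have {}dM k (s : R) w : `|k| <= r -> s \in `[0, T] -> norm2 w <= a ->
    norm2 (field f s (row_mx w p + k)) <= M.
  by rewrite !le_min => /and3P[_ kd _]; exact: dM.
have {}dL k (s : R) w : `|k| <= r -> s \in `[0, T] -> norm2 w <= a ->
    `|field_jacobian f s (row_mx w p + k)| <= L.
  by rewrite !le_min => /and3P[_ _ kd]; exact: dL.
pose Q := [set q : 'rV[R]_np | `|q - p| <= r].
have shiftp w q : row_mx w q = row_mx w p + row_mx 0 (q - p) :> 'rV[R]_(nx + np).
  by rewrite add_row_mx addr0 subrKC.
have norm_shift q : Q q -> `|row_mx (0 : 'rV[R]_nx) (q - p)| <= r.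
  by move=> Qq; apply: norm_row_mx => //; rewrite normr0 ltW.
have F_cont v q : Ca a T v -> Q q ->
    {within `[0, T], continuous (fun s => field f s (row_mx (v s) q))}.
  move=> [cv va] Qq; apply/subspace_continuousP => s sT.
  apply: (field_cvg C1).
  - by rewrite shiftp; apply: dU => //; [exact: norm_shift|exact: va].
  - exact: cvg_within.
  - apply: cvg_row_mx; last exact: cvg_cst.
    by move/subspace_continuousP : cv; exact.
have G_cont v : Ca a T v ->
    {within `[0, T], continuous (fun s => field_jacobian f s (row_mx (v s) p))}.
  move=> [cv va]; apply/subspace_continuousP => s sT.
  apply: (field_jacobian_cvg C1).
  - by apply: tube_U => //; exact: va.
  - exact: cvg_within.
  - apply: cvg_row_mx; last exact: cvg_cst.
    by move/subspace_continuousP : cv; exact.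
have F_le (s : R) w q : s \in `[0, T] -> norm2 w <= a -> Q q ->
    norm2 (field f s (row_mx w q)) <= M.
  by move=> sT wa Qq; rewrite shiftp; apply: dM => //; exact: norm_shift.
(* The successor keeps [L'] positive in dimension 0. *)
pose L' := (nx + np).+1%:R * L.
have L'_gt0 : 0 < L' by rewrite mulr_gt0// ltr0n.
have L_le : (nx + np)%:R * L <= L' by rewrite ler_pM2r// ler_nat.
have F_lip (s : R) w w' q q' : s \in `[0, T] ->
    norm2 w <= a -> norm2 w' <= a -> Q q -> Q q' ->
    `|field f s (row_mx w' q') - field f s (row_mx w q)| <=
      L' * `|row_mx w' q' - row_mx w q|.
  move=> sT wa wa' Qq Qq'; apply: le_trans (ler_wpM2r (normr_ge0 _) L_le).
  apply: (tube_lip C1 (ltW L_gt0) _ sT wa wa' Qq Qq') => k s' w'' kr s'T w''a.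
  by split; [exact: dU|exact: dL].
have G_le (s : R) w h : s \in `[0, T] -> norm2 w <= a ->
    `|h *m field_jacobian f s (row_mx w p)| <= L' * `|h : 'rV[R]_(nx + np)|.
  move=> sT wa; rewrite (le_trans (norm_mulmx _ _))//.
  apply: le_trans (ler_wpM2r (normr_ge0 _) L_le).
  rewrite mulrAC ler_wpM2r// ler_wpM2l//.
  by rewrite -[row_mx w p]addr0; apply: dL => //; rewrite normr0 ltW.
have F_diff := tube_diff C1 tube_U dU.
pose z0 : 'rV[R]_(nx + np) := row_mx x p.
have [d0 d0_gt0 near_z0] : exists2 d, 0 < d & forall h : 'rV[R]_(nx + np), `|h| <= d ->
    [/\ D (lsubmx (z0 + h), rsubmx (z0 + h)), Q (rsubmx (z0 + h)) &
        norm2 (lsubmx (z0 + h)) + M * T < a].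
  have cz : z0 + h @[h --> (0 : 'rV[R]_(nx + np))] --> z0.
    rewrite -[X in _ --> X]addr0.
    exact: (cvgD (FF := nbhs_filter (0 : 'rV[R]_(nx + np))) (cvg_cst z0) cvg_id).
  have cl : lsubmx (z0 + h) @[h --> (0 : 'rV[R]_(nx + np))] --> x.
    rewrite -(row_mxKl x p); apply: (cvg_comp _ _ cz); exact: continuous_lsubmx.
  have cr : rsubmx (z0 + h) @[h --> (0 : 'rV[R]_(nx + np))] --> p.
    rewrite -(row_mxKr x p); apply: (cvg_comp _ _ cz); exact: continuous_rsubmx.
  have nD : \forall h \near (0 : 'rV[R]_(nx + np)), D (lsubmx (z0 + h), rsubmx (z0 + h)).
    have Dxp : nbhs (x, p) D by apply: open_nbhs_nbhs; split=> //; exact: XThetaD.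
    exact: (cvg_pair cl cr Dxp).
  have nQ : \forall h \near (0 : 'rV[R]_(nx + np)), Q (rsubmx (z0 + h)).
    have /cvgrPdist_le/(_ r r_gt0) := cr.
    by apply: filterS => h; rewrite distrC.
  have na : \forall h \near (0 : 'rV[R]_(nx + np)), norm2 (lsubmx (z0 + h)) < a - M * T.
    have /cvgr_lt := cvg_comp _ _ cl (@continuous_norm2 R nx _).
    by apply; lra.
  have nDQa := filterI nD (filterI nQ na).
  have [d /= d_gt0 dP] := iffLR nbhs_norm0P (nDQa (nbhs_filter _) (nbhs_filter _)).
  exists (d / 2) => [|h hd]; first exact: divr_gt0.
  have [] := dP h; first by rewrite /= (le_lt_trans hd)// ltr_pdivrMr// ltr_pMr// ltr1n.
  by move=> Dh [Qh ah]; split=> //; rewrite -ltrBrDr.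
pose Phi (z : 'rV[R]_(nx + np)) := phi t (lsubmx z) (rsubmx z).
have safe h : `|h| <= d0 -> safe_start T a M Q (z0 + h).
  by move=> /near_z0[_ Qh /ltW].
have safe0 : safe_start T a M Q z0.
  by have := safe 0; rewrite normr0 addr0; apply; exact: ltW.
have z0p : rsubmx z0 = p by rewrite row_mxKr.
have iter_Phi h : `|h| <= d0 ->
    joint_iter (field f) n (z0 + h) u t @[n --> \oo] --> Phi (z0 + h).
  move=> hd; have [Dh Qh ah] := near_z0 h hd.
  have [phi0 phi_deriv] := phi_sol _ _ Dh.
  set y := lsubmx (z0 + h) in Dh ah phi0 phi_deriv.
  set q := rsubmx (z0 + h) in Dh Qh phi0 phi_deriv.
  pose v s := phi s y q; pose g s := f s (v s) q.
  have fieldE s : field f s (row_mx (v s) q) = g s.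
    by rewrite /field row_mxKl row_mxKr.
  have v_le s : s \in `[0, T] -> norm2 (v s) <= a.
    apply: (@solution_stays R nx T v g T_gt0 phi_deriv a M M_ge0).
    - by rewrite /v phi0.
    - by move=> s' s'T va; rewrite -fieldE; exact: F_le.
  have Cv : Ca a T v by split=> //; exact: (solution_continuous phi_deriv).
  apply: (joint_iter_cvg (ltW T_gt0) L'_gt0 F_cont F_le F_lip (safe h hd) uCa Cv _ tT).
  move=> s sT; have cg : {within `[0, T], continuous g}.
    have gE : g = fun r' => field f r' (row_mx (v r') q).
      by apply/funext => r'; rewrite fieldE.
    by rewrite gE; exact: F_cont.
  have -> : v s = v 0 + mx_integral g s by exact: solution_eq_integral phi_deriv cg _ sT.
  rewrite [v 0]phi0 /joint_picard.
  by congr (_ + _); apply: eq_mx_integral => r' _; rewrite fieldE.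
have diff_iter e : 0 < e -> exists2 d, 0 < d & forall n h, `|h| <= d ->
    `|joint_iter (field f) n (z0 + h) u t - joint_iter (field f) n z0 u t
      - h *m iter_jacobian (field f) (field_jacobian f) n z0 u t| <= e * `|h|.
  move=> e0; have w0 : 0 < expR (2 * L' * t) by exact: expR_gt0.
  have [d d_gt0 H] := joint_iter_diff (ltW T_gt0) L'_gt0 F_cont G_cont F_le F_lip
    G_le F_diff safe0 z0p uCa (divr_gt0 e0 w0).
  exists (Num.min d d0); first by rewrite lt_min d_gt0.
  move=> n h; rewrite le_min => /andP[hd hd0].
  rewrite (le_trans (H n h t hd (safe h hd0) tT))// mulrAC divfK// gt_eqF//.
have [dPhi JPhi] := jacobian_limit
  (g_ := fun n z => joint_iter (field f) n z u t) d0_gt0 iter_Phi diff_iter.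
have iterE n : uncurry_row (fun y q => picard_iter f n 0 y q u t) =
    fun z => joint_iter (field f) n z u t.
  by apply/funext => z; rewrite joint_iterE.
have J n : differentiable (fun z => joint_iter (field f) n z u t) z0 /\
    'J (fun z => joint_iter (field f) n z u t) z0 =
      iter_jacobian (field f) (field_jacobian f) n z0 u t.
  apply: jacobian_unique => e /diff_iter[d d_gt0 H].
  by exists d => // h hd; exact: H.
split=> [n||].
- by rewrite /differentiable_xp iterE; exact: (J n).1.
- exact: dPhi.
- have -> : (fun n => grad_xp (fun y q => picard_iter f n 0 y q u t) x p) =
      (fun n => iter_jacobian (field f) (field_jacobian f) n z0 u t).
    by apply/funext => n; rewrite /grad_xp iterE (J n).2.
  exact: JPhi.
Qed.
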